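(* Let $p,q$ be relatively prime positive integers with $|p-q|>1$. Then the stationary lagrangian cone $C_{p,q}\subset\mathbb R^4$ is strictly unstable, and this is true for lagrangian variations fixing a neighborhood of the cone vertex. That is, there is a smooth compactly supported lagrangian variation of $C_{p,q}$, fixing a neighborhood of the vertex, for which the second variation of area is strictly negative.
   Context: $\mathbb R^4=\mathbb C^2$ with its standard metric, complex structure $J$ and symplectic form. $C_{p,q}=\{r\gamma(s): r\ge0,\ 0\le s\le2\pi\sqrt{pq}\}$ is the cone over the closed curve $$\gamma(s)=\frac1{\sqrt{p+q}}\Big(\sqrt q\,e^{i\sqrt{p/q}\,s},\ i\sqrt p\,e^{-i\sqrt{q/p}\,s}\Big),\qquad 0\le s\le2\pi\sqrt{pq},$$ in the unit sphere $S^3$. It is lagrangian and hamiltonian stationary (area is critical for compactly supported hamiltonian variations). A lagrangian variation is a smooth one-parameter family of lagrangian surfaces through the given one. *)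

(* Defs.v *)
From Stdlib Require Export Reals ZArith Znumtheory List.
From Coquelicot Require Export Coquelicot.
Open Scope R_scope.

Definition C2 : Type := (C * C)%type.

(* The euclidean inner product is the real part of the hermitian one. *)
Definition inner (z w : C2) : R :=
  Re (fst z * Cconj (fst w) + snd z * Cconj (snd w))%C.

Definition J (z : C2) : C2 := ((Ci * fst z)%C, (Ci * snd z)%C).

Definition omega (z w : C2) : R := inner (J z) w.

Definition lin_indep (X Y : C2) : Prop :=
  forall a b : R, plus (scal a X) (scal b Y) = zero -> a = 0 /\ b = 0.

(* Area of the parallelogram spanned by X and Y (square root of the Gram
   determinant). *)
Definition area_element (X Y : C2) : R :=
  sqrt (inner X X * inner Y Y - inner X Y ^ 2).

Definition cis (x : R) : C := (cos x, sin x).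

Definition gamma (p q : Z) (s : R) : C2 :=
  let p := IZR p in
  let q := IZR q in
  scal (/ sqrt (p + q))
    ((RtoC (sqrt q) * cis (sqrt (p / q) * s))%C,
     (Ci * RtoC (sqrt p) * cis (- (sqrt (q / p) * s)))%C).

Definition period (p q : Z) : R := 2 * PI * sqrt (IZR p * IZR q).

Definition cone (p q : Z) (r s : R) : C2 := scal r (gamma p q s).

Inductive var := Vt | Vr | Vs.

Definition slice (i : var) (f : R -> R -> R -> R) (t r s : R) : R -> R :=
  match i with
  | Vt => fun x => f x r s
  | Vr => fun x => f t x s
  | Vs => fun x => f t r x
  end.

Definition coord (i : var) (t r s : R) : R :=
  match i with Vt => t | Vr => r | Vs => s end.

Definition partial (i : var) (f : R -> R -> R -> R) : R -> R -> R -> R :=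
  fun t r s => Derive (slice i f t r s) (coord i t r s).

Definition iter_partial (l : list var) (f : R -> R -> R -> R)
  : R -> R -> R -> R := fold_right partial f l.

(* For U open this is C^infinity on U: [Derive] being total, the existence of
   each partial derivative is required separately. *)
Definition smooth_on (U : R -> R -> R -> Prop) (f : R -> R -> R -> R) : Prop :=
  forall (l : list var) (t r s : R), U t r s ->
    continuous (fun x : R * R * R =>
      iter_partial l f (fst (fst x)) (snd (fst x)) (snd x)) (t, r, s) /\
    forall i : var, ex_derive (slice i (iter_partial l f) t r s) (coord i t r s).

Definition smooth_C2_on (U : R -> R -> R -> Prop) (F : R -> R -> R -> C2)
  : Prop :=
  smooth_on U (fun t r s => Re (fst (F t r s))) /\
  smooth_on U (fun t r s => Im (fst (F t r s))) /\
  smooth_on U (fun t r s => Re (snd (F t r s))) /\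
  smooth_on U (fun t r s => Im (snd (F t r s))).

Definition partial_C2 (i : var) (F : R -> R -> R -> C2) (t r s : R) : C2 :=
  ((partial i (fun t r s => Re (fst (F t r s))) t r s,
    partial i (fun t r s => Im (fst (F t r s))) t r s),
   (partial i (fun t r s => Re (snd (F t r s))) t r s,
    partial i (fun t r s => Im (snd (F t r s))) t r s)).

(* The surface at time t is the immersion F t of the punctured cone, i.e. of
   (0, oo) x R / (period p q) Z. It agrees with the cone for r <= a (a
   neighbourhood of the vertex) and for r >= b (compact support). *)
Record lagrangian_variation (p q : Z) (eps a b : R) (F : R -> R -> R -> C2)
  : Prop := {
  lv_smooth :
    smooth_C2_on (fun t r _ => Rabs t < eps /\ 0 < r) F;
  lv_periodic : forall t r s, Rabs t < eps -> 0 < r ->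
    F t r (s + period p q) = F t r s;
  lv_start : forall r s, 0 < r -> F 0 r s = cone p q r s;
  lv_support : forall t r s, Rabs t < eps -> 0 < r -> r <= a \/ b <= r ->
    F t r s = cone p q r s;
  lv_immersion : forall t r s, Rabs t < eps -> 0 < r ->
    lin_indep (partial_C2 Vr F t r s) (partial_C2 Vs F t r s);
  lv_lagrangian : forall t r s, Rabs t < eps -> 0 < r ->
    omega (partial_C2 Vr F t r s) (partial_C2 Vs F t r s) = 0
}.

(* Area of the part a <= r <= b of the surface at time t; the rest of the
   surface does not move. *)
Definition area (p q : Z) (a b : R) (F : R -> R -> R -> C2) (t : R) : R :=
  RInt (fun r =>
    RInt (fun s =>
      area_element (partial_C2 Vr F t r s) (partial_C2 Vs F t r s))
    0 (period p q)) a b.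

(* Derivatives are total functions here, so twice differentiability at 0 has
   to be asserted. *)
Definition negative_second_variation (A : R -> R) : Prop :=
  locally 0 (fun t => ex_derive A t) /\
  ex_derive (Derive A) 0 /\
  Derive_n A 2 0 < 0.

Definition strictly_unstable_cone (p q : Z) : Prop :=
  exists (eps a b : R) (F : R -> R -> R -> C2),
    0 < eps /\ 0 < a < b /\
    lagrangian_variation p q eps a b F /\
    negative_second_variation (area p q a b F).

(* Main.v *)
Require Import Defs.
From Stdlib Require Import Lra Lia Psatz IndefiniteDescription.

(** Write z_j = R_j e^(i th_j), I_j = R_j^2 / 2. In the action-angle coordinates
    (I_1, I_2, th_1, th_2) the cone is an affine Lagrangian plane: with
    sigma = s / sqrt (p q) it is th = (p, - q) sigma + const and
    2 (p + q) (I_1, I_2) = r^2 (q, p). Displace it inside the family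

      2 (p + q) (I_1, I_2) = r^2 (q + y, p - y),
      th = (p sigma + tau, - q sigma + tau + pi / 2).

    The symplectic form pulls back to a multiple of
    2 tau_sigma + 2 y + r y_r, so with x = ln r any g (x, sigma) gives an exactly
    Lagrangian surface through r^2 y = (r^2 g)_sigma and
    2 r^2 tau = - (r^2 g)_x. Taking g = - t w (x) cos (m sigma) gives
    y = t m w sin (m sigma) and tau = t (w + w' / 2) cos (m sigma): an explicit
    family, no Hamiltonian flow being needed. Its area element is
    (r / sqrt (p q)) sqrt W dr ds, where, with P = (q + y) (p - y),

      W = P (1 + tau_x^2) + y_x^2 / 2
          + (y_sigma^2 / 4 + (y_x^2 / 4 + tau_x y_sigma / 2)^2) / P.

    The factor 1 / r in w = chi (e x) / r makes the second variation invariant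
    under dilations of the cone. For this w, integrating over s, the second
    derivative of the area at t = 0 is a positive multiple of

      int_0^1 (p q / 4) (e^2 chi'' - chi)^2 + (m^2 / 2) (e chi' - chi)^2
              + ((m^4 - (p - q)^2 m^2) / (4 p q) - m^2) chi^2.

    At e = 0 this is ((p q - m^2)^2 - (p - q)^2 m^2) / (4 p q) int chi^2, and the
    numerator factors as (m - p) (m - q) (m + p) (m + q). It is negative exactly
    when the positive number m lies strictly between p and q, and |p - q| > 1
    leaves room for such an integer. By continuity a small e > 0 works:
    the cutoff is slow in ln r, and the deformation lives in
    1 <= r <= exp (1 / e).

    The main ingredients are [bump_exists] (a smooth compactly supported
    profile), [smooth_on_of_Ck] (smoothness through the closure properties of the
    classes C^n), [is_derive_double_RInt] (differentiation under the integral),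
    [deform_lagrangian] and [deform_gram] (geometry of the family),
    [deform_negative_second_variation] (the second variation is governed by
    [reduced_integrand]) and [exists_slow_scale] (its sign). *)

(** * A smooth bump function *)

(** [f] is [n] times differentiable on the whole line. *)
Fixpoint times_derivable (n : nat) (f : R -> R) : Prop :=
  match n with
  | O => True
  | S n => exists f', (forall x, is_derive f x (f' x)) /\ times_derivable n f'
  end.

Lemma times_derivable_ext n f g :
  (forall x, f x = g x) -> times_derivable n f -> times_derivable n g.
Proof.
  destruct n as [|n]; simpl; auto.
  intros E [f' [Hf H]]; exists f'; split; auto.
  intros x; apply is_derive_ext with f; auto.
Qed.

Lemma times_derivable_pred n f : times_derivable (S n) f -> times_derivable n f.
Proof.
  revert f; induction n as [|n IH]; intros f; [easy|].
  intros [f' [Hf H]]; exists f'; auto.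
Qed.

Lemma times_derivable_plus n f g : times_derivable n f -> times_derivable n g ->
  times_derivable n (fun x => f x + g x).
Proof.
  revert f g; induction n as [|n IH]; intros f g; [easy|].
  intros [f' [Hf Kf]] [g' [Hg Kg]]; exists (fun x => f' x + g' x); split; auto.
  intros x; apply (is_derive_plus f g); auto.
Qed.

Lemma times_derivable_scal n c f : times_derivable n f ->
  times_derivable n (fun x => c * f x).
Proof.
  revert f; induction n as [|n IH]; intros f; [easy|].
  intros [f' [Hf Kf]]; exists (fun x => c * f' x); split; auto.
  intros x; apply is_derive_scal; auto.
Qed.

Lemma times_derivable_mult n f g : times_derivable n f -> times_derivable n g ->
  times_derivable n (fun x => f x * g x).
Proof.
  revert f g; induction n as [|n IH]; intros f g Hf Hg; [easy|].
  assert (If := times_derivable_pred _ _ Hf).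
  assert (Ig := times_derivable_pred _ _ Hg).
  destruct Hf as [f' [Hf Kf]], Hg as [g' [Hg Kg]].
  exists (fun x => f' x * g x + f x * g' x); split.
  - intros x; apply (is_derive_mult f g); auto; intros; apply Rmult_comm.
  - apply times_derivable_plus; apply IH; auto.
Qed.

Lemma times_derivable_reflect n f c : times_derivable n f ->
  times_derivable n (fun x => f (c - x)).
Proof.
  revert f; induction n as [|n IH]; intros f; [easy|].
  intros [f' [Hf Kf]]; exists (fun x => -1 * f' (c - x)); split.
  - intros x; apply (is_derive_comp f (fun x => c - x)); auto.
    auto_derive; [easy|ring].
  - apply times_derivable_scal; auto.
Qed.

Lemma times_derivable_Derive n f :
  times_derivable (S n) f ->
  forall x, is_derive (Derive_n f n) x (Derive_n f (S n) x).
Proof.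
  assert (G : forall k j g, times_derivable (S (k + j)) g ->
    times_derivable (S j) (Derive_n g k)).
  { clear; intros k; induction k as [|k IH]; intros j g H; [exact H|].
    destruct (IH (S j) g) as [f' [Hf H']].
    - replace (S (k + S j)) with (S (S k + j)) by lia; exact H.
    - apply times_derivable_ext with f'; auto.
      intros x; symmetry; apply is_derive_unique; auto. }
  intros H x. destruct (G n O f) as [f' [Hf _]].
  - rewrite Nat.add_0_r; exact H.
  - simpl; rewrite (is_derive_unique _ _ _ (Hf x)); auto.
Qed.

(** The flat functions x^(-k) e^(-1/x), extended by 0 to x <= 0. Their span is
    closed under differentiation. *)
Definition flat (k : nat) (x : R) : R :=
  if Rle_dec x 0 then 0 else (/ x) ^ k * exp (- / x).

Lemma exp_INR_mult n x : exp (INR n * x) = exp x ^ n.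
Proof.
  induction n as [|n IH].
  - simpl; rewrite Rmult_0_l; apply exp_0.
  - rewrite S_INR, Rmult_plus_distr_r, Rmult_1_l, exp_plus, IH; simpl; ring.
Qed.

(** From exp (y / N) >= y / N with N = n + 1. *)
Lemma exp_ge_pow n y : 0 < y -> (y / INR (S n)) ^ S n <= exp y.
Proof.
  intros Hy; assert (Hn : 0 < INR (S n)) by (apply lt_0_INR; lia).
  replace (exp y) with (exp (y / INR (S n)) ^ S n).
  - apply pow_incr; split.
    + apply Rlt_le, Rdiv_lt_0_compat; auto.
    + generalize (exp_ineq1_le (y / INR (S n))); lra.
  - rewrite <- exp_INR_mult. f_equal. field. lra.
Qed.

(** This decay at 0 gives differentiability there, by [is_derive_quadratic]. *)
Lemma flat_quadratic k : exists M, forall x, Rabs (flat k x) <= M * x ^ 2.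
Proof.
  exists (INR (S (S k)) ^ S (S k)); intros x; unfold flat.
  assert (Hn : 0 < INR (S (S k))) by (apply lt_0_INR; lia).
  destruct (Rle_dec x 0) as [H|H].
  - rewrite Rabs_R0; apply Rmult_le_pos; [apply pow_le; lra|apply pow2_ge_0].
  - assert (Hy : 0 < / x) by (apply Rinv_0_lt_compat; lra).
    rewrite Rabs_right; [|apply Rle_ge, Rmult_le_pos; [apply pow_le; lra|
      apply Rlt_le, exp_pos]].
    assert (E := exp_ge_pow (S k) (/ x) Hy).
    rewrite exp_Ropp. set (y := / x) in *.
    replace x with (/ y) by (unfold y; rewrite Rinv_inv; reflexivity).
    unfold Rdiv in E. rewrite Rpow_mult_distr, pow_inv in E.
    assert (HN : 0 < INR (S (S k)) ^ S (S k)) by (apply pow_lt; auto).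
    set (N := INR (S (S k)) ^ S (S k)) in *; clearbody N.
    assert (He := exp_pos y).
    apply Rmult_le_reg_r with (exp y * y ^ 2).
    { apply Rmult_lt_0_compat; auto; apply pow_lt; auto. }
    replace (y ^ k * / exp y * (exp y * y ^ 2)) with (y ^ (S (S k)))
      by (simpl; field; lra).
    replace (N * (/ y) ^ 2 * (exp y * y ^ 2)) with (N * exp y) by (field; lra).
    apply Rmult_le_reg_r with (/ N); [apply Rinv_0_lt_compat; auto|].
    apply Rle_trans with (1 := E). right; field; lra.
Qed.

Lemma is_derive_quadratic f M :
  (forall x, Rabs (f x) <= M * x ^ 2) -> is_derive f 0 0.
Proof.
  intros H. apply is_derive_Reals. intros e He.
  assert (f0 : f 0 = 0).
  { generalize (H 0) (Rabs_pos (f 0)); intros; apply Rabs_eq_0; nra. }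
  assert (HM : 0 <= M) by (generalize (H 1) (Rabs_pos (f 1)); intros; nra).
  assert (Hd : 0 < e / (M + 1)) by (apply Rdiv_lt_0_compat; lra).
  exists (mkposreal _ Hd); simpl; intros h h0 Hh.
  rewrite Rplus_0_l, f0, !Rminus_0_r. unfold Rdiv; rewrite Rabs_mult, Rabs_inv.
  assert (Hp := Rabs_pos_lt h h0).
  apply Rmult_lt_reg_r with (Rabs h); auto.
  rewrite Rmult_assoc, Rinv_l, Rmult_1_r by lra.
  apply Rle_lt_trans with (1 := H h).
  rewrite <- (pow2_abs h).
  apply (Rmult_lt_compat_r (M + 1)) in Hh; [|lra].
  unfold Rdiv in Hh; rewrite Rmult_assoc, Rinv_l, Rmult_1_r in Hh by lra.
  nra.
Qed.

Lemma flat_derive k x :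
  is_derive (flat k) x (flat (S (S k)) x + - INR k * flat (S k) x).
Proof.
  destruct (Rtotal_order x 0) as [Hx|[->|Hx]].
  - apply is_derive_ext_loc with (fun _ => 0).
    + exists (mkposreal (- x) ltac:(lra)); intros y Hy; unfold flat.
      destruct (Rle_dec y 0); auto.
      apply Rabs_def2 in Hy; simpl in Hy; unfold minus, plus, opp in Hy;
        simpl in Hy; lra.
    + unfold flat; destruct (Rle_dec x 0); [|lra].
      rewrite Rmult_0_r, Rplus_0_r; apply @is_derive_const.
  - destruct (flat_quadratic k) as [M HM].
    replace (_ + _) with 0; [apply is_derive_quadratic with M; auto|].
    unfold flat; destruct (Rle_dec 0 0); [|lra]; ring.
  - apply is_derive_ext_loc with (fun y => (/ y) ^ k * exp (- / y)).
    + exists (mkposreal x Hx); intros y Hy; unfold flat.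
      destruct (Rle_dec y 0); auto.
      apply Rabs_def2 in Hy; simpl in Hy; unfold minus, plus, opp in Hy;
        simpl in Hy; lra.
    + unfold flat; destruct (Rle_dec x 0); [lra|].
      auto_derive; [lra|].
      destruct k as [|k]; simpl pred; simpl pow; [simpl; field; lra|].
      rewrite S_INR; field; lra.
Qed.

Lemma flat_smooth n k : times_derivable n (flat k).
Proof.
  revert k; induction n as [|n IH]; intros k; [easy|].
  exists (fun x => flat (S (S k)) x + - INR k * flat (S k) x); split.
  - apply flat_derive.
  - apply times_derivable_plus; [|apply times_derivable_scal]; auto.
Qed.

Lemma flat0_bound x : 0 <= flat 0 x <= 1.
Proof.
  unfold flat; destruct (Rle_dec x 0); [lra|].
  simpl; rewrite Rmult_1_l; split; [apply Rlt_le, exp_pos|].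
  rewrite <- exp_0.
  left; apply exp_increasing.
  generalize (Rinv_0_lt_compat x); lra.
Qed.

(** The sequence [chi] lists the successive derivatives of a smooth bump
    function that is positive exactly on (0, 1). *)
Lemma bump_exists : exists chi : nat -> R -> R,
  (forall n x, is_derive (chi n) x (chi (S n) x)) /\
  (forall x, 0 <= chi O x <= 1) /\
  (forall x, 0 < x < 1 -> 0 < chi O x) /\
  (forall n x, x <= 0 \/ 1 <= x -> chi n x = 0).
Proof.
  set (b := fun x => flat 0 x * flat 0 (1 - x)).
  assert (D : forall n x, is_derive (Derive_n b n) x (Derive_n b (S n) x)).
  { intros n; apply times_derivable_Derive, times_derivable_mult.
    - apply flat_smooth.
    - apply (times_derivable_reflect (S n) (flat 0)), flat_smooth. }
  exists (Derive_n b); split; [exact D|split; [|split]].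
  - intros x; change (0 <= flat 0 x * flat 0 (1 - x) <= 1).
    destruct (flat0_bound x), (flat0_bound (1 - x)); nra.
  - intros x Hx; simpl; unfold b, flat.
    destruct (Rle_dec x 0), (Rle_dec (1 - x) 0); try lra.
    simpl; rewrite !Rmult_1_l; apply Rmult_lt_0_compat; apply exp_pos.
  - assert (Hout : forall n x, x < 0 \/ 1 < x -> Derive_n b n x = 0).
    { induction n as [|n IH]; intros x Hx.
      - simpl; unfold b, flat.
        destruct (Rle_dec x 0), (Rle_dec (1 - x) 0); try lra; ring.
      - simpl; rewrite <- (Derive_const 0 x); apply Derive_ext_loc.
        assert (O : open (fun y => y < 0 \/ 1 < y))
          by (apply open_or; [apply open_lt|apply open_gt]).
        apply filter_imp with (2 := O x Hx); auto. }
    (* at the two end points, by continuity *)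
    intros n x Hx. destruct (Req_dec (Derive_n b n x) 0) as [E|E]; auto.
    exfalso.
    assert (C : continuous (Derive_n b n) x)
      by (apply (ex_derive_continuous (Derive_n b n) x); eexists; apply D).
    assert (L : locally x (fun y => Derive_n b n y <> 0)).
    { apply (C (fun z : R => z <> 0)), (open_neq 0 _ E). }
    destruct L as [d L].
    assert (Hd := cond_pos d).
    destruct Hx as [Hx|Hx].
    + apply (L (x - d / 2)); [|apply Hout; left; lra].
      change (Rabs (x - d / 2 - x) < d); apply Rabs_def1; lra.
    + apply (L (x + d / 2)); [|apply Hout; right; lra].
      change (Rabs (x + d / 2 - x) < d); apply Rabs_def1; lra.
Qed.

(** * The classes C^n in three variables *)

Lemma continuous_pair (U V W : UniformSpace) (f : U -> V) (g : U -> W) x :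
  continuous f x -> continuous g x -> continuous (fun z => (f z, g z)) x.
Proof.
  intros Hf Hg; apply (continuous_comp_2 f g (fun a b => (a, b))); auto.
  apply continuous_ext with (fun z => z); [intros []; auto|].
  apply continuous_id.
Qed.

Definition uncurry3 (f : R -> R -> R -> R) (x : R * R * R) : R :=
  f (fst (fst x)) (snd (fst x)) (snd x).

(** On an open [U] this is the class C^n: continuity, and partial derivatives in
    C^(n-1). *)
Fixpoint Ck (n : nat) (U : R -> R -> R -> Prop) (f : R -> R -> R -> R) : Prop :=
  (forall t r s, U t r s -> continuous (uncurry3 f) (t, r, s)) /\
  match n with
  | O => True
  | S n => forall i, exists g,
      (forall t r s, U t r s ->
        is_derive (slice i f t r s) (coord i t r s) (g t r s)) /\ Ck n U g
  end.

Definition open3 (U : R -> R -> R -> Prop) : Prop :=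
  open (fun x : R * R * R => U (fst (fst x)) (snd (fst x)) (snd x)).

(** The line through (t, r, s) in the direction of the coordinate [i]. *)
Definition section_point (i : var) (t r s x : R) : R * R * R :=
  match i with Vt => (x, r, s) | Vr => (t, x, s) | Vs => (t, r, x) end.

Lemma section_point_continuous i t r s x :
  continuous (section_point i t r s) x.
Proof.
  destruct i; simpl; repeat apply continuous_pair;
    try apply continuous_id; apply continuous_const.
Qed.

Lemma slice_section_point i f t r s x :
  slice i f t r s x = uncurry3 f (section_point i t r s x).
Proof. destruct i; reflexivity. Qed.

Lemma section_point_coord i t r s :
  section_point i t r s (coord i t r s) = (t, r, s).
Proof. destruct i; reflexivity. Qed.

Lemma open3_section U i t r s : open3 U -> U t r s ->
  locally (coord i t r s) (fun x =>
    let y := section_point i t r s x in U (fst (fst y)) (snd (fst y)) (snd y)).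
Proof.
  intros O H.
  apply (section_point_continuous i t r s (coord i t r s)
    (fun y => U (fst (fst y)) (snd (fst y)) (snd y))).
  rewrite section_point_coord; apply O; exact H.
Qed.

Section ClassCk.
Variable U : R -> R -> R -> Prop.
Hypothesis HU : open3 U.

Lemma slice_eq_near f g i t r s :
  (forall t r s, U t r s -> f t r s = g t r s) -> U t r s ->
  locally (coord i t r s) (fun x => slice i f t r s x = slice i g t r s x).
Proof.
  intros E H. apply filter_imp with (2 := open3_section U i t r s HU H).
  intros x Hx; rewrite !slice_section_point; apply E; exact Hx.
Qed.

Lemma Ck_ext n f g : (forall t r s, U t r s -> f t r s = g t r s) ->
  Ck n U f -> Ck n U g.
Proof.
  intros E H.
  assert (C : forall t r s, U t r s -> continuous (uncurry3 g) (t, r, s)).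
  { intros t r s Hx. apply continuous_ext_loc with (uncurry3 f).
    - apply filter_imp with (2 := HU (t, r, s) Hx).
      intros y Hy; apply E; exact Hy.
    - destruct n; apply H; exact Hx. }
  destruct n as [|n]; (split; [exact C|]); [easy|].
  intros i; destruct H as [_ H]; destruct (H i) as [f' [Hf Kf]].
  exists f'; split; auto.
  intros t r s Hx; apply is_derive_ext_loc with (slice i f t r s); auto.
  apply slice_eq_near; auto.
Qed.

Lemma Ck_continuous n f : Ck n U f ->
  forall t r s, U t r s -> continuous (uncurry3 f) (t, r, s).
Proof. destruct n; intros H; apply H. Qed.

Lemma Ck_pred n f : Ck (S n) U f -> Ck n U f.
Proof.
  revert f; induction n as [|n IH]; intros f [C H]; (split; [exact C|]);
    [easy|].
  intros i; destruct (H i) as [g [Hg Kg]]; exists g; auto.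
Qed.

Lemma Ck_const n c : Ck n U (fun _ _ _ => c).
Proof.
  revert c; induction n as [|n IH]; intros c; split;
    try (intros; apply @continuous_const); [easy|].
  intros i; exists (fun _ _ _ => 0); split; auto.
  intros t r s _; destruct i; apply @is_derive_const.
Qed.

Lemma Ck_coord n i : Ck n U (coord i).
Proof.
  assert (C : forall x, continuous (uncurry3 (coord i)) x).
  { intros [[t r] s]; destruct i; unfold uncurry3; simpl;
      repeat (apply (continuous_comp (fun x : R * R * R => fst x) fst) ||
              apply (continuous_comp (fun x : R * R * R => fst x) snd));
      try apply continuous_fst; apply continuous_snd. }
  destruct n as [|n]; (split; [intros; apply C|]); [easy|].
  intros j.
  exists (fun _ _ _ => match i, j with
    | Vt, Vt | Vr, Vr | Vs, Vs => 1 | _, _ => 0 end); split.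
  - intros t r s _; destruct i, j; simpl;
      (apply @is_derive_const || apply @is_derive_id).
  - apply Ck_const.
Qed.

Lemma Ck_plus n f g : Ck n U f -> Ck n U g ->
  Ck n U (fun t r s => f t r s + g t r s).
Proof.
  revert f g; induction n as [|n IH]; intros f g [Cf Hf] [Cg Hg];
    (split; [intros; apply (continuous_plus (uncurry3 f) (uncurry3 g)); auto|]);
    [easy|].
  intros i; destruct (Hf i) as [f' [Df Kf]], (Hg i) as [g' [Dg Kg]].
  exists (fun t r s => f' t r s + g' t r s); split; auto.
  intros t r s Hx.
  assert (D := is_derive_plus _ _ _ _ _ (Df _ _ _ Hx) (Dg _ _ _ Hx)).
  destruct i; exact D.
Qed.

Lemma Ck_mult n f g : Ck n U f -> Ck n U g ->
  Ck n U (fun t r s => f t r s * g t r s).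
Proof.
  revert f g; induction n as [|n IH]; intros f g Hf Hg;
    assert (Cf := Ck_continuous _ _ Hf); assert (Cg := Ck_continuous _ _ Hg);
    (split; [intros; apply (continuous_mult (uncurry3 f) (uncurry3 g)); auto|]);
    [easy|].
  assert (If := Ck_pred _ _ Hf); assert (Ig := Ck_pred _ _ Hg).
  intros i; destruct Hf as [_ Hf], Hg as [_ Hg].
  destruct (Hf i) as [f' [Df Kf]], (Hg i) as [g' [Dg Kg]].
  exists (fun t r s => f' t r s * g t r s + f t r s * g' t r s); split.
  - intros t r s Hx.
    assert (D := is_derive_mult _ _ _ _ _ (Df _ _ _ Hx) (Dg _ _ _ Hx) Rmult_comm).
    destruct i; exact D.
  - apply Ck_plus; apply IH; auto.
Qed.

(** Composition with a function h 0 of one variable, smooth on [D], given with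
    the list [h] of its derivatives. *)
Lemma Ck_comp (D : R -> Prop) (h : nat -> R -> R) n f k :
  (forall k x, D x -> is_derive (h k) x (h (S k) x)) ->
  (forall t r s, U t r s -> D (f t r s)) ->
  Ck n U f -> Ck n U (fun t r s => h k (f t r s)).
Proof.
  intros Hh HD; revert k; induction n as [|n IH]; intros k Hf;
    assert (Cf := Ck_continuous _ _ Hf);
    (split; [intros t r s Hx; apply (continuous_comp (uncurry3 f) (h k)); auto;
      apply (ex_derive_continuous (h k)); eexists; apply Hh, HD; exact Hx|]);
    [easy|].
  assert (If := Ck_pred _ _ Hf).
  intros i; destruct Hf as [_ Hf]; destruct (Hf i) as [f' [Df Kf]].
  exists (fun t r s => f' t r s * h (S k) (f t r s)); split.
  - intros t r s Hx.
    assert (Dh : is_derive (h k) (slice i f t r s (coord i t r s))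
      (h (S k) (f t r s))) by (destruct i; apply Hh, HD; exact Hx).
    assert (Dc := is_derive_comp _ _ _ _ _ Dh (Df _ _ _ Hx)).
    destruct i; exact Dc.
  - apply Ck_mult; auto.
Qed.

Lemma Ck_partial n i f : Ck (S n) U f -> Ck n U (partial i f).
Proof.
  intros [_ H]; destruct (H i) as [g [Hg Kg]].
  apply Ck_ext with g; auto.
  intros t r s Hx; symmetry; apply is_derive_unique; auto.
Qed.

Lemma smooth_on_of_Ck f : (forall n, Ck n U f) -> smooth_on U f.
Proof.
  intros H l t r s Hx.
  assert (K : forall n, Ck n U (iter_partial l f)).
  { clear t r s Hx; induction l as [|i l IH]; [exact H|].
    intros n; apply Ck_partial, IH. }
  split.
  - apply (Ck_continuous _ _ (K O)); auto.
  - intros i; destruct (K 1%nat) as [_ K1]; destruct (K1 i) as [g [Hg _]].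
    exists (g t r s); auto.
Qed.

Lemma Ck_cos n f : Ck n U f -> Ck n U (fun t r s => cos (f t r s)).
Proof.
  intros H.
  (* the k-th derivative of cos is its translate by k pi / 2 *)
  apply (Ck_comp (fun _ => True) (fun k x => cos (x + INR k * (PI / 2)))
    n (fun t r s => f t r s) O) in H; auto.
  - apply Ck_ext with (2 := H); intros; f_equal; simpl; ring.
  - intros k x _; rewrite S_INR.
    replace (x + (INR k + 1) * (PI / 2)) with (PI / 2 + (x + INR k * (PI / 2)))
      by ring.
    rewrite <- (Ropp_involutive (cos (PI / 2 + _))), <- sin_cos.
    auto_derive; [easy|ring].
Qed.

Lemma Ck_sin n f : Ck n U f -> Ck n U (fun t r s => sin (f t r s)).
Proof.
  intros H; apply Ck_ext with (fun t r s => cos (f t r s + - (PI / 2))).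
  - intros; rewrite <- cos_neg, Ropp_plus_distr, Ropp_involutive, Rplus_comm.
    apply cos_shift.
  - apply Ck_cos, Ck_plus; auto; apply Ck_const.
Qed.

(** The derivatives of x |-> / x. *)
Definition inv_derivs (k : nat) (x : R) : R :=
  (-1) ^ k * INR (fact k) * (/ x) ^ S k.

Lemma is_derive_inv_derivs k x : x <> 0 ->
  is_derive (inv_derivs k) x (inv_derivs (S k) x).
Proof.
  intros Hx; unfold inv_derivs; auto_derive; auto.
  rewrite fact_simpl, mult_INR; simpl pow; simpl Nat.pred.
  change (match k with O => 1 | S _ => INR k + 1 end) with (INR (S k)).
  rewrite S_INR; field; auto.
Qed.

Lemma Ck_inv n f : (forall t r s, U t r s -> f t r s <> 0) -> Ck n U f ->
  Ck n U (fun t r s => / f t r s).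
Proof.
  intros H0 H. apply (Ck_comp (fun x => x <> 0) inv_derivs n f O) in H; auto.
  - apply Ck_ext with (2 := H); intros; unfold inv_derivs; simpl; ring.
  - intros; apply is_derive_inv_derivs; auto.
Qed.

Lemma Ck_ln n f : (forall t r s, U t r s -> 0 < f t r s) -> Ck n U f ->
  Ck n U (fun t r s => ln (f t r s)).
Proof.
  intros H0 H.
  apply (Ck_comp (fun x => 0 < x)
    (fun k => match k with O => ln | S k => inv_derivs k end) n f O) in H; auto.
  intros [|k] x Hx.
  - unfold inv_derivs; simpl; auto_derive; auto; field; lra.
  - apply is_derive_inv_derivs; lra.
Qed.

Lemma Ck_sqrt n f : (forall t r s, U t r s -> 0 < f t r s) -> Ck n U f ->
  Ck n U (fun t r s => sqrt (f t r s)).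
Proof.
  intros H0 H.
  (* the k-th derivative of sqrt is c k * sqrt x / x ^ k *)
  set (c := fix c (k : nat) : R :=
    match k with O => 1 | S k => c k * (1 / 2 - INR k) end).
  apply (Ck_comp (fun x => 0 < x)
    (fun k x => c k * sqrt x * (/ x) ^ k) n f O) in H; auto.
  - apply Ck_ext with (2 := H); intros; simpl; ring.
  - intros k x Hx; change (c (S k)) with (c k * (1 / 2 - INR k)).
    auto_derive; [repeat split; auto; lra|].
    assert (Hs := sqrt_lt_R0 x Hx). rewrite <- (sqrt_sqrt x) by lra.
    rewrite sqrt_square by lra.
    destruct k as [|k]; simpl pow; simpl Nat.pred; [simpl; field; lra|].
    rewrite ?S_INR. field; lra.
Qed.

Lemma Ck_opp n f : Ck n U f -> Ck n U (fun t r s => - f t r s).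
Proof.
  intros H; apply Ck_ext with (fun t r s => -1 * f t r s); auto.
  - intros; ring.
  - apply Ck_mult; auto; apply Ck_const.
Qed.

Lemma Ck_pow n f k : Ck n U f -> Ck n U (fun t r s => f t r s ^ k).
Proof.
  intros H; induction k as [|k IH]; simpl.
  - apply Ck_const.
  - apply Ck_mult; auto.
Qed.

Lemma Ck_t n : Ck n U (fun t _ _ => t).
Proof. exact (Ck_coord n Vt). Qed.

Lemma Ck_r n : Ck n U (fun _ r _ => r).
Proof. exact (Ck_coord n Vr). Qed.

Lemma Ck_s n : Ck n U (fun _ _ s => s).
Proof. exact (Ck_coord n Vs). Qed.

End ClassCk.

(** Reduces C^n regularity along the sums, products, powers, sines and cosines of
    an expression. *)
Ltac ck := repeat first
  [ assumption
  | apply Ck_const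
  | apply Ck_t | apply Ck_r | apply Ck_s
  | apply Ck_plus
  | apply Ck_opp; [assumption|]
  | apply Ck_mult
  | apply Ck_pow
  | apply Ck_sin; [assumption|]
  | apply Ck_cos; [assumption|] ].

(** * Integrals depending on parameters *)

(** By compactness of [a, b] the continuity of [f] at the points (x0, s) is
    uniform in s. *)
Lemma continuous_RInt_param (T : UniformSpace) (f : T -> R -> R) (x0 : T)
  (a b : R) : a <= b ->
  (forall s, a <= s <= b ->
    continuous (fun z : T * R => f (fst z) (snd z)) (x0, s)) ->
  locally x0 (fun x => ex_RInt (f x) a b) ->
  continuous (fun x => RInt (f x) a b) x0.
Proof.
  intros Hab Hc Hi.
  apply filterlim_locally; intros e.
  assert (He : 0 < e / (2 * (b - a + 1)))
    by (apply Rdiv_lt_0_compat; [apply cond_pos|lra]).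
  set (e1 := mkposreal _ He).
  assert (Hd : forall s, exists d : posreal, a <= s <= b ->
    forall (x : T) y, ball x0 d x -> Rabs (y - s) < d ->
      Rabs (f x y - f x0 s) < e1 / 2).
  { intros s.
    destruct (Rle_dec a s) as [H1|H1]; [|exists (mkposreal 1 Rlt_0_1); lra].
    destruct (Rle_dec s b) as [H2|H2]; [|exists (mkposreal 1 Rlt_0_1); lra].
    assert (C := Hc s (conj H1 H2)).
    assert (C' := proj1 (filterlim_locally _ _) C (pos_div_2 e1)).
    destruct C' as [d Hd]; exists d; intros _ x y Hx Hy.
    apply (Hd (x, y)); split; auto. }
  destruct (functional_choice _ Hd) as [d Hd'].
  destruct (compactness_value_1d a b d) as [d0 H0].
  assert (Hx0 := locally_ball x0 d0).
  generalize (filter_and _ _ Hi Hx0); apply filter_imp; intros x [Ix Hx].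
  assert (I0 : ex_RInt (f x0) a b) by exact (locally_singleton _ _ Hi).
  change (Rabs (RInt (f x) a b - RInt (f x0) a b) < e).
  replace (RInt (f x) a b - RInt (f x0) a b)
    with (RInt (fun s => f x s - f x0 s) a b) by (apply @RInt_minus; auto).
  apply Rle_lt_trans with ((b - a) * e1).
  - apply abs_RInt_le_const; auto.
    + apply @ex_RInt_minus; auto.
    + intros s Hs. apply Rnot_lt_le; intros Hlt.
      apply (H0 s Hs); intros [s' [Hs' [H1 H2]]].
      assert (B : ball x0 (d s') x) by (apply ball_le with d0; auto).
      assert (E1 := Hd' s' Hs' x s B H1).
      assert (E2 := Hd' s' Hs' x0 s (ball_center _ _) H1).
      apply Rlt_not_le with (1 := Hlt).
      change (Rabs (f x s - f x0 s) <= e1).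
      replace (f x s - f x0 s) with ((f x s - f x0 s') - (f x0 s - f x0 s'))
        by ring.
      apply Rle_trans with (1 := Rabs_triang _ _); rewrite Rabs_Ropp.
      simpl in *; lra.
  - simpl. apply Rmult_lt_reg_r with (2 * (b - a + 1)); [lra|].
    replace ((b - a) * (e / (2 * (b - a + 1))) * (2 * (b - a + 1)))
      with ((b - a) * e) by (field; lra).
    assert (H := cond_pos e); nra.
Qed.

(** Differentiation under a double integral, r ranging over [a, b] and s over
    [0, c]: Leibniz' rule in each variable, the inner integrals being jointly
    continuous in (t, r). *)
Lemma is_derive_double_RInt (f g : R -> R -> R -> R) (e a b c : R) :
  0 < a <= b -> 0 <= c ->
  (forall t r s, Rabs t < e -> 0 < r ->
    continuous (uncurry3 f) (t, r, s)) ->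
  (forall t r s, Rabs t < e -> 0 < r ->
    continuous (uncurry3 g) (t, r, s)) ->
  (forall t r s, Rabs t < e -> 0 < r ->
    is_derive (fun t => f t r s) t (g t r s)) ->
  forall t, Rabs t < e ->
  is_derive (fun t => RInt (fun r => RInt (f t r) 0 c) a b) t
    (RInt (fun r => RInt (g t r) 0 c) a b).
Proof.
  intros Hab Hc Cf Cg D.
  assert (Oe : open (fun t => Rabs t < e)).
  { apply (open_comp Rabs (fun y => y < e)); [|apply open_lt].
    intros; apply continuous_Rabs. }
  (* continuity in s and existence of the inner integrals *)
  assert (Sl : forall h : R -> R -> R -> R, (forall t r s, Rabs t < e -> 0 < r ->
    continuous (uncurry3 h) (t, r, s)) ->
    forall t r s, Rabs t < e -> 0 < r -> continuous (h t r) s).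
  { intros h Ch t r s Ht Hr.
    apply (continuous_comp (fun s => (t, r, s))
      (uncurry3 h)); auto.
    apply continuous_pair; [apply continuous_const|apply continuous_id]. }
  assert (Ex : forall h : R -> R -> R -> R, (forall t r s, Rabs t < e -> 0 < r ->
    continuous (uncurry3 h) (t, r, s)) ->
    forall t r, Rabs t < e -> 0 < r -> ex_RInt (h t r) 0 c).
  { intros h Ch t r Ht Hr; apply @ex_RInt_continuous; intros; apply Sl; auto. }
  assert (O2 : open (fun z : R * R => Rabs (fst z) < e /\ 0 < snd z)).
  { apply open_and.
    - apply (open_comp fst (fun t => Rabs t < e)); [|exact Oe].
      intros; apply continuous_fst.
    - apply (open_comp snd (fun r => 0 < r)); [|apply open_gt].
      intros; apply continuous_snd. }
  (* joint continuity of the inner integrals *)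
  assert (C2 : forall h : R -> R -> R -> R, (forall t r s, Rabs t < e -> 0 < r ->
    continuous (uncurry3 h) (t, r, s)) ->
    forall t r, Rabs t < e -> 0 < r ->
      continuous (fun z : R * R => RInt (h (fst z) (snd z)) 0 c) (t, r)).
  { intros h Ch t r Ht Hr.
    apply (continuous_RInt_param _ (fun z : R * R => h (fst z) (snd z)));
      auto.
    generalize (O2 (t, r) (conj Ht Hr)); apply filter_imp.
    intros z [H1 H2]; apply Ex; auto. }
  assert (Er : forall h : R -> R -> R -> R, (forall t r s, Rabs t < e -> 0 < r ->
    continuous (uncurry3 h) (t, r, s)) ->
    forall t, Rabs t < e -> ex_RInt (fun r => RInt (h t r) 0 c) a b).
  { intros h Ch t Ht; apply @ex_RInt_continuous; intros r Hr.
    rewrite Rmin_left in Hr by lra.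
    apply (continuous_comp (fun r => (t, r))
      (fun z : R * R => RInt (h (fst z) (snd z)) 0 c)).
    - apply continuous_pair; [apply continuous_const|apply continuous_id].
    - apply C2; auto; lra. }
  assert (D1 : forall t r, Rabs t < e -> 0 < r ->
    is_derive (fun t => RInt (f t r) 0 c) t (RInt (g t r) 0 c)).
  { intros t r Ht Hr.
    replace (RInt (g t r) 0 c)
      with (RInt (fun s => Derive (fun u => f u r s) t) 0 c)
      by (apply RInt_ext; intros; apply is_derive_unique; auto).
    apply (is_derive_RInt_param (fun t s => f t r s)).
    - generalize (Oe t Ht); apply filter_imp; intros u Hu s _.
      exists (g u r s); auto.
    - intros s _; apply continuity_2d_pt_filterlim.
      change (continuous (fun z : R * R => Derive (fun u => f u r (snd z)) (fst z))
        (t, s)).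
      apply continuous_ext_loc with (fun z : R * R => g (fst z) r (snd z)).
      + assert (L : locally (t, s) (fun z : R * R => Rabs (fst z) < e)).
        { apply (continuous_fst t s (fun u => Rabs u < e)), (Oe t Ht). }
        revert L; apply filter_imp; intros z Hz; symmetry.
        apply is_derive_unique; auto.
      + apply (continuous_comp (fun z : R * R => (fst z, r, snd z))
         (uncurry3 g)); auto.
        repeat apply continuous_pair; auto using continuous_const;
          [apply continuous_fst|apply continuous_snd].
    - generalize (Oe t Ht); apply filter_imp; intros u Hu; apply Ex; auto. }
  intros t Ht.
  replace (RInt (fun r => RInt (g t r) 0 c) a b)
    with (RInt (fun r => Derive (fun u => RInt (f u r) 0 c) t) a b).
  2:{ apply RInt_ext; intros r Hr; rewrite Rmin_left in Hr by lra.
      apply is_derive_unique, D1; auto; lra. }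
  apply (is_derive_RInt_param (fun t r => RInt (f t r) 0 c)).
  - generalize (Oe t Ht); apply filter_imp; intros u Hu r Hr.
    rewrite Rmin_left in Hr by lra.
    exists (RInt (g u r) 0 c); apply D1; auto; lra.
  - intros r Hr; rewrite Rmin_left in Hr by lra.
    apply continuity_2d_pt_filterlim.
    change (continuous (fun z : R * R =>
      Derive (fun u => RInt (f u (snd z)) 0 c) (fst z)) (t, r)).
    assert (Hr0 : 0 < r) by lra.
    apply continuous_ext_loc
      with (fun z : R * R => RInt (g (fst z) (snd z)) 0 c).
    + generalize (O2 (t, r) (conj Ht Hr0)); apply filter_imp.
      intros z [H1 H2]; symmetry; apply is_derive_unique, D1; auto.
    + apply C2; auto.
  - generalize (Oe t Ht); apply filter_imp; intros u Hu; apply Er; auto.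
Qed.

(** * One-variable calculus *)

(** Replaces the only [Derive] at the given point by the value known from [D]. *)
Ltac derive_value D :=
  match type of D with is_derive _ ?x ?l =>
    replace (Derive _ x) with l by (symmetry; apply is_derive_unique; exact D)
  end.

Lemma sqrt_ratio a b : 0 < a -> 0 < b -> sqrt (a / b) = a / sqrt (a * b).
Proof.
  intros Ha Hb.
  assert (H1 := sqrt_lt_R0 a Ha); assert (H2 := sqrt_lt_R0 b Hb).
  rewrite sqrt_div_alt, sqrt_mult by lra.
  rewrite <- (sqrt_sqrt a) at 2 by lra; field; lra.
Qed.

(** The logarithmic derivative of sqrt (f / n) is half that of f. *)
Lemma sqrt_log_derive (f : R -> R) x f' n : 0 < f x -> 0 < n ->
  is_derive f x f' ->
  is_derive (fun x => sqrt (f x / n)) x (sqrt (f x / n) * (f' / (2 * f x))).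
Proof.
  intros Hf Hn D.
  assert (Hfn : 0 < f x / n) by (apply Rdiv_lt_0_compat; auto).
  assert (Hs := sqrt_lt_R0 _ Hfn).
  auto_derive; [repeat split; auto; eexists; exact D|].
  change (fun x => f x) with f; rewrite (is_derive_unique _ _ _ D).
  change (f x * / n) with (f x / n).
  assert (E := sqrt_sqrt (f x / n) (Rlt_le _ _ Hfn)).
  set (u := sqrt (f x / n)) in *; clearbody u.
  replace (f x) with (u * u * n) by (rewrite E; field; lra).
  field; split; lra.
Qed.

Lemma log_derive_id_mult (f : R -> R) x u : x <> 0 ->
  is_derive f x (f x * u) ->
  is_derive (fun x => x * f x) x (x * f x * (/ x + u)).
Proof.
  intros Hx D; auto_derive; [eexists; exact D|].
  derive_value D; field; auto.
Qed.

(** The second derivative at 0 of c sqrt w, read off from any function [g1] that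
    is its derivative near 0. *)
Lemma sqrt_second_derivative (w w1 g1 : R -> R) (w2 g2 c d : R) : 0 < d ->
  (forall t, Rabs t < d -> 0 < w t) ->
  (forall t, Rabs t < d -> is_derive w t (w1 t)) ->
  is_derive w1 0 w2 ->
  (forall t, Rabs t < d -> is_derive (fun t => c * sqrt (w t)) t (g1 t)) ->
  is_derive g1 0 g2 ->
  g2 = c * (w2 / (2 * sqrt (w 0)) - w1 0 ^ 2 / (4 * w 0 * sqrt (w 0))).
Proof.
  intros Hd Hw Dw Dw1 Dg Dg1.
  assert (E : forall t, Rabs t < d -> g1 t = c * (w1 t / (2 * sqrt (w t)))).
  { intros t Ht; rewrite <- (is_derive_unique _ _ _ (Dg t Ht)).
    apply is_derive_unique; assert (D := Dw t Ht).
    assert (Hs := sqrt_lt_R0 _ (Hw t Ht)).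
    auto_derive; [repeat split; auto; eexists; exact D|].
    derive_value D; field; lra. }
  assert (H0 : Rabs 0 < d) by (rewrite Rabs_R0; auto).
  assert (D0 := Dw 0 H0).
  assert (Hs := sqrt_lt_R0 _ (Hw 0 H0)).
  rewrite <- (is_derive_unique _ _ _ Dg1).
  apply is_derive_unique.
  apply is_derive_ext_loc with (fun t => c * (w1 t / (2 * sqrt (w t)))).
  - exists (mkposreal d Hd); intros t Ht; symmetry; apply E.
    change (Rabs (t - 0) < d) in Ht; rewrite Rminus_0_r in Ht; exact Ht.
  - assert (Hw0 := Hw 0 H0).
    auto_derive; [repeat split; auto; try (eexists; eassumption); lra|].
    change (fun x => w1 x) with w1; change (fun x => w x) with w.
    rewrite (is_derive_unique w1 0 _ Dw1), (is_derive_unique w 0 _ D0).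
    assert (Eq := sqrt_sqrt (w 0) (Rlt_le _ _ Hw0)).
    set (u := sqrt (w 0)) in *; clearbody u; rewrite <- Eq.
    field; lra.
Qed.

Lemma RInt_sin2_cos2 k L a b : k <> 0 -> sin (k * L) = 0 ->
  RInt (fun s => a * sin (k * s) ^ 2 + b * cos (k * s) ^ 2) 0 L
  = (a + b) / 2 * L.
Proof.
  intros Hk HL; apply is_RInt_unique.
  (* a primitive, from sin^2, cos^2 = (1 -/+ cos (2 k s)) / 2 *)
  set (G := fun s => (a + b) / 2 * s
    + (b - a) / (2 * k) * (sin (k * s) * cos (k * s))).
  replace ((a + b) / 2 * L) with (minus (G L) (G 0)).
  2:{ unfold minus, plus, opp, G; simpl.
      rewrite HL, !Rmult_0_r, sin_0; field; auto. }
  apply (is_RInt_derive G).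
  - intros s _; unfold G; auto_derive; auto.
    assert (E := sin2_cos2 (k * s)); unfold Rsqr in E.
    set (x := sin (k * s)) in *; set (y := cos (k * s)) in *.
    transitivity ((a + b) / 2 * (x * x + y * y) + (b - a) / 2 * (y * y - x * x));
      [rewrite E; field; auto|field].
  - intros s _; apply (ex_derive_continuous (fun s =>
      a * sin (k * s) ^ 2 + b * cos (k * s) ^ 2)); auto_derive; auto.
Qed.

(** * Vectors in polar form *)

(** The vector (R1 e^(i th1) (u1 + i v1), i R2 e^(i th2) (u2 + i v2)). The
    derivative of (R1 e^(i th1), i R2 e^(i th2)) has this form, u_j being the
    derivative of ln R_j and v_j that of th_j. *)
Definition polar_vec (R1 th1 u1 v1 R2 th2 u2 v2 : R) : C2 :=
  ((R1 * (u1 * cos th1 - v1 * sin th1), R1 * (u1 * sin th1 + v1 * cos th1)),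
   (- (R2 * (u2 * sin th2 + v2 * cos th2)), R2 * (u2 * cos th2 - v2 * sin th2))).

Lemma inner_polar_vec R1 th1 u1 v1 u1' v1' R2 th2 u2 v2 u2' v2' :
  inner (polar_vec R1 th1 u1 v1 R2 th2 u2 v2)
        (polar_vec R1 th1 u1' v1' R2 th2 u2' v2') =
  R1 ^ 2 * (u1 * u1' + v1 * v1') + R2 ^ 2 * (u2 * u2' + v2 * v2').
Proof.
  unfold inner, polar_vec; simpl.
  assert (E1 := sin2_cos2 th1); assert (E2 := sin2_cos2 th2).
  unfold Rsqr in E1, E2.
  transitivity (R1 ^ 2 * (u1 * u1' + v1 * v1')
      * (sin th1 * sin th1 + cos th1 * cos th1)
    + R2 ^ 2 * (u2 * u2' + v2 * v2')
      * (sin th2 * sin th2 + cos th2 * cos th2)); [ring|].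
  rewrite E1, E2; ring.
Qed.

Lemma omega_polar_vec R1 th1 u1 v1 u1' v1' R2 th2 u2 v2 u2' v2' :
  omega (polar_vec R1 th1 u1 v1 R2 th2 u2 v2)
        (polar_vec R1 th1 u1' v1' R2 th2 u2' v2') =
  R1 ^ 2 * (u1 * v1' - v1 * u1') + R2 ^ 2 * (u2 * v2' - v2 * u2').
Proof.
  rewrite <- (Rplus_0_l (R1 ^ 2 * _ + _)).
  replace (R1 ^ 2 * (u1 * v1' - v1 * u1'))
    with (R1 ^ 2 * (- v1 * u1' + u1 * v1')) by ring.
  replace (R2 ^ 2 * (u2 * v2' - v2 * u2'))
    with (R2 ^ 2 * (- v2 * u2' + u2 * v2')) by ring.
  rewrite Rplus_0_l, <- (inner_polar_vec R1 th1 _ _ _ _ R2 th2).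
  unfold omega; f_equal.
  unfold J, polar_vec, Ci, Cmult; simpl; f_equal; f_equal; ring.
Qed.

Lemma lin_indep_of_gram X Z :
  0 < inner X X * inner Z Z - inner X Z ^ 2 -> lin_indep X Z.
Proof.
  intros H a b E.
  assert (L : forall V, a * inner X V + b * inner Z V = 0).
  { intros V.
    transitivity (inner (plus (scal a X) (scal b Z)) V).
    - destruct X as [[x1 x2] [x3 x4]], Z as [[y1 y2] [y3 y4]],
        V as [[z1 z2] [z3 z4]].
      unfold inner, plus, scal; simpl; unfold mult, plus, scal; simpl;
      unfold mult; simpl; ring.
    - rewrite E. destruct V as [[z1 z2] [z3 z4]].
      unfold inner, zero; simpl; unfold zero; simpl; ring. }
  assert (S : inner Z X = inner X Z).
  { destruct X as [[x1 x2] [x3 x4]], Z as [[y1 y2] [y3 y4]].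
    unfold inner; simpl; ring. }
  assert (LX := L X); assert (LY := L Z); rewrite S in LX.
  set (G := inner X X * inner Z Z - inner X Z ^ 2) in *.
  split; apply Rmult_eq_reg_r with G; try lra; rewrite Rmult_0_l; unfold G.
  - replace (_ * _) with ((a * inner X X + b * inner X Z) * inner Z Z
      - (a * inner X Z + b * inner Z Z) * inner X Z) by ring.
    rewrite LX, LY; ring.
  - replace (_ * _) with ((a * inner X Z + b * inner Z Z) * inner X X
      - (a * inner X X + b * inner X Z) * inner X Z) by ring.
    rewrite LX, LY; ring.
Qed.

Lemma polar_derive (rad ang : R -> R) x u v :
  is_derive rad x (rad x * u) -> is_derive ang x v ->
  is_derive (fun x => rad x * cos (ang x)) x
    (rad x * (u * cos (ang x) - v * sin (ang x))) /\
  is_derive (fun x => rad x * sin (ang x)) x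
    (rad x * (u * sin (ang x) + v * cos (ang x))).
Proof.
  intros Hr Ha; split.
  - auto_derive; [split; [eexists; exact Hr|split; [eexists; exact Ha|easy]]|].
    change (fun x => rad x) with rad; change (fun x => ang x) with ang.
    rewrite (is_derive_unique _ _ _ Hr), (is_derive_unique _ _ _ Ha); ring.
  - auto_derive; [split; [eexists; exact Hr|split; [eexists; exact Ha|easy]]|].
    change (fun x => rad x) with rad; change (fun x => ang x) with ang.
    rewrite (is_derive_unique _ _ _ Hr), (is_derive_unique _ _ _ Ha); ring.
Qed.

Lemma partial_C2_polar i (R1 th1 R2 th2 : R -> R -> R -> R) u1 v1 u2 v2 t r s :
  is_derive (slice i R1 t r s) (coord i t r s) (R1 t r s * u1) ->
  is_derive (slice i th1 t r s) (coord i t r s) v1 ->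
  is_derive (slice i R2 t r s) (coord i t r s) (R2 t r s * u2) ->
  is_derive (slice i th2 t r s) (coord i t r s) v2 ->
  partial_C2 i (fun t r s =>
    ((R1 t r s * cos (th1 t r s), R1 t r s * sin (th1 t r s)),
     (- (R2 t r s * sin (th2 t r s)), R2 t r s * cos (th2 t r s)))) t r s =
  polar_vec (R1 t r s) (th1 t r s) u1 v1 (R2 t r s) (th2 t r s) u2 v2.
Proof.
  intros H1 H2 H3 H4.
  assert (E : forall f, slice i f t r s (coord i t r s) = f t r s)
    by (destruct i; reflexivity).
  rewrite <- (E R1) in H1; rewrite <- (E R2) in H3.
  destruct (polar_derive _ _ _ _ _ H1 H2) as [D1 D2].
  destruct (polar_derive _ _ _ _ _ H3 H4) as [D3 D4].
  rewrite !E in *.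
  apply is_derive_opp in D4.
  unfold partial_C2, polar_vec; f_equal; f_equal; unfold partial;
    apply is_derive_unique; destruct i; assumption.
Qed.

(** * The deformed cones *)

Section Deformation.
(** The bump function and its derivatives, the cutoff scale [e], the mode [m] and
    the weights of the cone. *)
Variables (chi : nat -> R -> R) (e m p q : R).
Hypothesis Hchi : forall n x, is_derive (chi n) x (chi (S n) x).
Hypothesis chi_bound : forall x, 0 <= chi O x <= 1.
Hypothesis chi_out : forall n x, x <= 0 \/ 1 <= x -> chi n x = 0.
Hypotheses (Hp : 1 <= p) (Hq : 1 <= q) (Hm : 0 < m) (He : 0 < e).

(** The profile w as a function of r, followed by its first two derivatives with
    respect to x = ln r. *)
Definition amplitude (r : R) : R := chi 0 (e * ln r) / r.
Definition amplitude1 (r : R) : R :=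
  (e * chi 1 (e * ln r) - chi 0 (e * ln r)) / r.
Definition amplitude2 (r : R) : R :=
  (e ^ 2 * chi 2 (e * ln r) - 2 * e * chi 1 (e * ln r) + chi 0 (e * ln r)) / r.

(** m sigma = [frequency] * s. *)
Definition frequency : R := m / sqrt (p * q).

(** At time t the actions are shifted by y = t * [shift] and the angles by
    tau = t * [twist]. The suffix x stands for the derivative r d/dr, and
    [shift_s] is the derivative with respect to sigma = s / sqrt (p q), whence the
    factor m ^ 2. *)
Definition shift (r s : R) : R := m * amplitude r * sin (frequency * s).
Definition twist (r s : R) : R :=
  (amplitude r + amplitude1 r / 2) * cos (frequency * s).
Definition shift_x (r s : R) : R := m * amplitude1 r * sin (frequency * s).
Definition twist_x (r s : R) : R :=
  (amplitude1 r + amplitude2 r / 2) * cos (frequency * s).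
Definition shift_s (r s : R) : R := m ^ 2 * amplitude r * cos (frequency * s).

Definition radius1 (t r s : R) : R := r * sqrt ((q + t * shift r s) / (p + q)).
Definition radius2 (t r s : R) : R := r * sqrt ((p - t * shift r s) / (p + q)).
Definition angle1 (t r s : R) : R := sqrt (p / q) * s + t * twist r s.
Definition angle2 (t r s : R) : R := - (sqrt (q / p) * s) + t * twist r s.

(** The deformed surface (R1 e^(i th1), i R2 e^(i th2)). *)
Definition deform (t r s : R) : C2 :=
  ((radius1 t r s * cos (angle1 t r s), radius1 t r s * sin (angle1 t r s)),
   (- (radius2 t r s * sin (angle2 t r s)),
    radius2 t r s * cos (angle2 t r s))).

(** The functions P and W of the area element, [gram_cross] being the coefficient
    of t ^ 2 in y_x^2 / 4 + tau_x y_sigma / 2. *)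
Definition action_product (t r s : R) : R :=
  (q + t * shift r s) * (p - t * shift r s).
Definition gram_cross (r s : R) : R :=
  shift_x r s ^ 2 / 4 + twist_x r s * shift_s r s / 2.
Definition gram_factor (t r s : R) : R :=
  action_product t r s * (1 + t ^ 2 * twist_x r s ^ 2)
  + t ^ 2 * shift_x r s ^ 2 / 2
  + (t ^ 2 * shift_s r s ^ 2 / 4 + t ^ 4 * gram_cross r s ^ 2)
    / action_product t r s.

(** The area element with respect to dr ds. *)
Definition density (t r s : R) : R :=
  r / sqrt (p * q) * sqrt (gram_factor t r s).

Lemma sqrt_pq : 0 < sqrt (p * q).
Proof. apply sqrt_lt_R0; nra. Qed.

Lemma amplitude_derive r : 0 < r -> is_derive amplitude r (amplitude1 r / r).
Proof.
  intros Hr; unfold amplitude, amplitude1.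
  assert (D := fun n x => is_derive_unique _ _ _ (Hchi n x)).
  auto_derive; [repeat split; auto; try lra; eexists; apply Hchi|].
  rewrite D; field; lra.
Qed.

Lemma amplitude1_derive r : 0 < r -> is_derive amplitude1 r (amplitude2 r / r).
Proof.
  intros Hr; unfold amplitude1, amplitude2.
  assert (D := fun n x => is_derive_unique _ _ _ (Hchi n x)).
  auto_derive; [repeat split; auto; try lra; eexists; apply Hchi|].
  rewrite !D; field; lra.
Qed.

Lemma shift_derive_r r s : 0 < r ->
  is_derive (fun r => shift r s) r (shift_x r s / r).
Proof.
  intros Hr; unfold shift, shift_x. assert (D := amplitude_derive r Hr).
  auto_derive; [eexists; apply D|].
  change (fun x => amplitude x) with amplitude.
  rewrite (is_derive_unique _ _ _ D); field; lra.
Qed.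

Lemma twist_derive_r r s : 0 < r ->
  is_derive (fun r => twist r s) r (twist_x r s / r).
Proof.
  intros Hr; unfold twist, twist_x.
  assert (D := amplitude_derive r Hr); assert (D1 := amplitude1_derive r Hr).
  auto_derive; [split; [eexists; apply D|split; [eexists; apply D1|easy]]|].
  change (fun x => amplitude x) with amplitude.
  change (fun x => amplitude1 x) with amplitude1.
  rewrite (is_derive_unique _ _ _ D), (is_derive_unique _ _ _ D1); field; lra.
Qed.

Lemma shift_derive_s r s : is_derive (shift r) s (shift_s r s / sqrt (p * q)).
Proof.
  unfold shift, shift_s, frequency; auto_derive; auto.
  field; generalize sqrt_pq; lra.
Qed.

Lemma twist_derive_s r s :
  is_derive (twist r) s (- (shift r s + shift_x r s / 2) / sqrt (p * q)).
Proof.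
  unfold twist, shift, shift_x, frequency; auto_derive; auto.
  field; generalize sqrt_pq; lra.
Qed.

(** For |t| < [time_bound] the shifts stay below 1 / 2, so that the actions remain
    positive. *)
Definition time_bound : R := / (2 * m).

(** [amplitude] is at most 1, since it vanishes for r <= 1 and chi <= 1. *)
Lemma shift_small t r s : Rabs t < time_bound -> 0 < r ->
  Rabs (t * shift r s) <= 1 / 2.
Proof.
  intros Ht Hr.
  assert (Ha : Rabs (amplitude r) <= 1).
  { unfold amplitude; destruct (Rle_dec (e * ln r) 0) as [H|H].
    - rewrite chi_out by auto; unfold Rdiv; rewrite Rmult_0_l, Rabs_R0; lra.
    - assert (Hl : 1 < r).
      { apply ln_lt_inv; try lra; rewrite ln_1.
        apply Rnot_le_lt; intros Hl; apply H; nra. }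
      destruct (chi_bound (e * ln r)).
      rewrite Rabs_pos_eq by (apply Rdiv_le_0_compat; lra).
      apply Rmult_le_reg_r with r; [lra|].
      unfold Rdiv; rewrite Rmult_assoc, Rinv_l; lra. }
  assert (Hs : Rabs (sin (frequency * s)) <= 1)
    by (apply Rabs_le; destruct (SIN_bound (frequency * s)); lra).
  unfold shift; rewrite !Rabs_mult, (Rabs_pos_eq m) by lra.
  assert (Rabs t * m <= 1 / 2).
  { unfold time_bound in Ht; apply (Rmult_lt_compat_r m) in Ht; [|lra].
    replace (/ (2 * m) * m) with (1 / 2) in Ht by (field; lra); lra. }
  assert (H0 := Rabs_pos t).
  assert (H1 := Rabs_pos (amplitude r)); assert (H2 := Rabs_pos (sin (frequency * s))).
  replace (Rabs t * (m * Rabs (amplitude r) * Rabs (sin (frequency * s))))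
    with ((Rabs t * m) * (Rabs (amplitude r) * Rabs (sin (frequency * s)))) by ring.
  assert (Rabs (amplitude r) * Rabs (sin (frequency * s)) <= 1) by nra.
  assert (0 <= Rabs (amplitude r) * Rabs (sin (frequency * s))) by nra.
  assert (0 <= Rabs t * m) by nra.
  nra.
Qed.

Lemma action1_pos t r s : Rabs t < time_bound -> 0 < r -> 0 < q + t * shift r s.
Proof.
  intros Ht Hr; generalize (shift_small t r s Ht Hr); intros H.
  apply Rabs_le_between in H; lra.
Qed.

Lemma action2_pos t r s : Rabs t < time_bound -> 0 < r -> 0 < p - t * shift r s.
Proof.
  intros Ht Hr; generalize (shift_small t r s Ht Hr); intros H.
  apply Rabs_le_between in H; lra.
Qed.

Lemma action_product_pos t r s : Rabs t < time_bound -> 0 < r ->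
  0 < action_product t r s.
Proof.
  intros; apply Rmult_lt_0_compat; [apply action1_pos|apply action2_pos]; auto.
Qed.

Lemma gram_factor_pos t r s : Rabs t < time_bound -> 0 < r ->
  0 < gram_factor t r s.
Proof.
  intros Ht Hr; assert (HP := action_product_pos t r s Ht Hr); unfold gram_factor.
  assert (0 < action_product t r s * (1 + t ^ 2 * twist_x r s ^ 2)).
  { apply Rmult_lt_0_compat; auto.
    generalize (Rmult_le_pos _ _ (pow2_ge_0 t) (pow2_ge_0 (twist_x r s))); lra. }
  assert (0 <= t ^ 2 * shift_x r s ^ 2)
    by (apply Rmult_le_pos; apply pow2_ge_0).
  assert (0 <= (t ^ 2 * shift_s r s ^ 2 / 4 + t ^ 4 * gram_cross r s ^ 2)
    / action_product t r s).
  { apply Rdiv_le_0_compat; auto.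
    generalize (Rmult_le_pos _ _ (pow2_ge_0 t) (pow2_ge_0 (shift_s r s))).
    generalize (Rmult_le_pos _ _ (pow2_ge_0 (t ^ 2))
      (pow2_ge_0 (gram_cross r s))).
    replace ((t ^ 2) ^ 2) with (t ^ 4) by ring. lra. }
  lra.
Qed.

Lemma deform_dr t r s : Rabs t < time_bound -> 0 < r ->
  partial_C2 Vr deform t r s =
  polar_vec (radius1 t r s) (angle1 t r s)
    ((1 + t * shift_x r s / (2 * (q + t * shift r s))) / r) (t * twist_x r s / r)
    (radius2 t r s) (angle2 t r s)
    ((1 - t * shift_x r s / (2 * (p - t * shift r s))) / r) (t * twist_x r s / r).
Proof.
  intros Ht Hr.
  assert (HA := action1_pos t r s Ht Hr).
  assert (HB := action2_pos t r s Ht Hr).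
  assert (DY := shift_derive_r r s Hr); assert (DT := twist_derive_r r s Hr).
  apply partial_C2_polar; simpl.
  - unfold radius1.
    assert (D : is_derive (fun r => q + t * shift r s) r
      (t * (shift_x r s / r))).
    { auto_derive; [eexists; exact DY|].
      derive_value DY; ring. }
    apply (sqrt_log_derive (fun r => q + t * shift r s) r _ (p + q)) in D;
      try lra.
    apply (log_derive_id_mult
      (fun r => sqrt ((q + t * shift r s) / (p + q)))) in D; [|lra].
    replace (_ * ((1 + _) / r)) with
      (r * sqrt ((q + t * shift r s) / (p + q)) *
        (/ r + t * (shift_x r s / r) / (2 * (q + t * shift r s))))
      by (field; lra).
    exact D.
  - unfold angle1; auto_derive; [eexists; exact DT|].
    derive_value DT; field; lra.
  - unfold radius2.
    assert (D : is_derive (fun r => p - t * shift r s) r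
      (- t * (shift_x r s / r))).
    { auto_derive; [eexists; exact DY|].
      derive_value DY; ring. }
    apply (sqrt_log_derive (fun r => p - t * shift r s) r _ (p + q)) in D;
      try lra.
    apply (log_derive_id_mult
      (fun r => sqrt ((p - t * shift r s) / (p + q)))) in D; [|lra].
    replace (_ * ((1 - _) / r)) with
      (r * sqrt ((p - t * shift r s) / (p + q)) *
        (/ r + - t * (shift_x r s / r) / (2 * (p - t * shift r s))))
      by (field; lra).
    exact D.
  - unfold angle2; auto_derive; [eexists; exact DT|].
    derive_value DT; field; lra.
Qed.

Lemma deform_ds t r s : Rabs t < time_bound -> 0 < r ->
  partial_C2 Vs deform t r s =
  polar_vec (radius1 t r s) (angle1 t r s)
    (t * shift_s r s / (2 * (q + t * shift r s)) / sqrt (p * q))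
    ((p - t * (shift r s + shift_x r s / 2)) / sqrt (p * q))
    (radius2 t r s) (angle2 t r s)
    (- (t * shift_s r s / (2 * (p - t * shift r s))) / sqrt (p * q))
    (- (q + t * (shift r s + shift_x r s / 2)) / sqrt (p * q)).
Proof.
  intros Ht Hr. assert (Hk := sqrt_pq).
  assert (HA := action1_pos t r s Ht Hr).
  assert (HB := action2_pos t r s Ht Hr).
  assert (DY := shift_derive_s r s); assert (DT := twist_derive_s r s).
  apply partial_C2_polar; simpl.
  - unfold radius1.
    assert (D : is_derive (fun s => q + t * shift r s) s
      (t * (shift_s r s / sqrt (p * q)))).
    { auto_derive; [eexists; exact DY|].
      derive_value DY; ring. }
    apply (sqrt_log_derive (fun s => q + t * shift r s) s _ (p + q)) in D;
      try lra.
    apply (is_derive_scal _ _ r) in D.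
    replace (_ * (_ / sqrt (p * q))) with
      (r * (sqrt ((q + t * shift r s) / (p + q)) *
        (t * (shift_s r s / sqrt (p * q)) / (2 * (q + t * shift r s)))))
      by (field; lra).
    exact D.
  - unfold angle1; rewrite sqrt_ratio by lra. auto_derive; [eexists; exact DT|].
    derive_value DT; field; lra.
  - unfold radius2.
    assert (D : is_derive (fun s => p - t * shift r s) s
      (- t * (shift_s r s / sqrt (p * q)))).
    { auto_derive; [eexists; exact DY|].
      derive_value DY; ring. }
    apply (sqrt_log_derive (fun s => p - t * shift r s) s _ (p + q)) in D;
      try lra.
    apply (is_derive_scal _ _ r) in D.
    replace (_ * (_ / sqrt (p * q))) with
      (r * (sqrt ((p - t * shift r s) / (p + q)) *
        (- t * (shift_s r s / sqrt (p * q)) / (2 * (p - t * shift r s)))))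
      by (field; lra).
    exact D.
  - unfold angle2; rewrite sqrt_ratio, (Rmult_comm q p) by lra.
    auto_derive; [eexists; exact DT|].
    derive_value DT; field; lra.
Qed.

Lemma radius_sqr t r s : Rabs t < time_bound -> 0 < r ->
  radius1 t r s ^ 2 = r ^ 2 * (q + t * shift r s) / (p + q) /\
  radius2 t r s ^ 2 = r ^ 2 * (p - t * shift r s) / (p + q).
Proof.
  intros Ht Hr.
  assert (HA := action1_pos t r s Ht Hr).
  assert (HB := action2_pos t r s Ht Hr).
  unfold radius1, radius2; rewrite !Rpow_mult_distr, !pow2_sqrt;
    try (apply Rlt_le, Rdiv_lt_0_compat; lra).
  split; field; lra.
Qed.

(** Uses that the sigma-derivative of [twist] is - [shift] - [shift_x] / 2. *)
Lemma deform_lagrangian t r s : Rabs t < time_bound -> 0 < r ->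
  omega (partial_C2 Vr deform t r s) (partial_C2 Vs deform t r s) = 0.
Proof.
  intros Ht Hr. assert (Hk := sqrt_pq).
  assert (HA := action1_pos t r s Ht Hr).
  assert (HB := action2_pos t r s Ht Hr).
  rewrite deform_dr, deform_ds, omega_polar_vec by auto.
  destruct (radius_sqr t r s Ht Hr) as [-> ->].
  field; repeat split; lra.
Qed.

(** The vectors are orthogonal for the symplectic form, so this is also the
    squared modulus of the complex determinant of the two partial derivatives. *)
Lemma deform_gram t r s : Rabs t < time_bound -> 0 < r ->
  let X := partial_C2 Vr deform t r s in
  let Z := partial_C2 Vs deform t r s in
  inner X X * inner Z Z - inner X Z ^ 2
  = (r / sqrt (p * q)) ^ 2 * gram_factor t r s.
Proof.
  intros Ht Hr; simpl. assert (Hk := sqrt_pq).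
  assert (HA := action1_pos t r s Ht Hr).
  assert (HB := action2_pos t r s Ht Hr).
  rewrite deform_dr, deform_ds, !inner_polar_vec by auto.
  destruct (radius_sqr t r s Ht Hr) as [-> ->].
  unfold gram_factor, action_product, gram_cross.
  field; repeat split; lra.
Qed.

Lemma deform_area_element t r s : Rabs t < time_bound -> 0 < r ->
  area_element (partial_C2 Vr deform t r s) (partial_C2 Vs deform t r s) =
  density t r s.
Proof.
  intros Ht Hr; unfold area_element; rewrite deform_gram by auto.
  assert (Hk := sqrt_pq).
  rewrite sqrt_mult_alt by apply pow2_ge_0.
  rewrite sqrt_pow2; auto. apply Rlt_le, Rdiv_lt_0_compat; auto.
Qed.

(** The parameters (t, r, s) for which the deformed cones are considered. *)
Definition domain (t r s : R) : Prop := Rabs t < time_bound /\ 0 < r.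

Lemma domain_open : open3 domain.
Proof.
  unfold open3, domain; apply open_and.
  - apply (open_comp (fun x : R * R * R => Rabs (fst (fst x)))
      (fun y => y < time_bound)); [|apply open_lt].
    intros x _; apply (continuous_comp (fun x : R * R * R => fst (fst x)) Rabs);
      [|apply continuous_Rabs].
    destruct x as [[t r] s];
      apply (continuous_comp (fun x : R * R * R => fst x) fst);
      apply continuous_fst.
  - apply (open_comp (fun x : R * R * R => snd (fst x)) (fun y => 0 < y));
      [|apply open_gt].
    intros [[t r] s] _; apply (continuous_comp (fun x : R * R * R => fst x) snd);
      [apply continuous_fst|apply continuous_snd].
Qed.

Let HU := domain_open.

Lemma Ck_chi n k : Ck n domain (fun _ r _ => chi k (e * ln r)).
Proof.
  apply (Ck_comp domain (fun _ => True) chi n (fun _ r _ => e * ln r) k); auto.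
  ck. apply (Ck_ln domain n (fun _ r _ => r)); [intros ? ? ? []; auto|ck].
Qed.

Lemma Ck_inv_r n : Ck n domain (fun _ r _ => / r).
Proof.
  apply (Ck_inv domain HU n (fun _ r _ => r)); [|ck].
  intros t r s [_ Hr]; lra.
Qed.

Lemma Ck_amplitude n : Ck n domain (fun _ r _ => amplitude r) /\
  Ck n domain (fun _ r _ => amplitude1 r) /\
  Ck n domain (fun _ r _ => amplitude2 r).
Proof.
  assert (H := Ck_chi n); assert (Hi := Ck_inv_r n).
  unfold amplitude, amplitude1, amplitude2, Rdiv, Rminus.
  repeat split; ck; apply H.
Qed.

Lemma Ck_displacement n : Ck n domain (fun _ r s => shift r s) /\
  Ck n domain (fun _ r s => twist r s) /\
  Ck n domain (fun _ r s => shift_x r s) /\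
  Ck n domain (fun _ r s => twist_x r s) /\
  Ck n domain (fun _ r s => shift_s r s).
Proof.
  destruct (Ck_amplitude n) as [H [H1 H2]].
  unfold shift, twist, shift_x, twist_x, shift_s, Rdiv; repeat split; ck.
Qed.

Lemma Ck_actions n : Ck n domain (fun t r s => q + t * shift r s) /\
  Ck n domain (fun t r s => p - t * shift r s).
Proof.
  destruct (Ck_displacement n) as [H _]; unfold Rminus; split; ck.
Qed.

Lemma Ck_polar n : Ck n domain radius1 /\ Ck n domain radius2 /\
  Ck n domain angle1 /\ Ck n domain angle2.
Proof.
  destruct (Ck_displacement n) as [HY [HT _]], (Ck_actions n) as [HA HB].
  unfold radius1, radius2, angle1, angle2; repeat split; ck.
  - apply (Ck_sqrt domain HU n (fun t r s => (q + t * shift r s) / (p + q))).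
    + intros t r s [Ht Hr]; apply Rdiv_lt_0_compat;
        [apply action1_pos; auto|lra].
    + unfold Rdiv; ck.
  - apply (Ck_sqrt domain HU n (fun t r s => (p - t * shift r s) / (p + q))).
    + intros t r s [Ht Hr]; apply Rdiv_lt_0_compat;
        [apply action2_pos; auto|lra].
    + unfold Rdiv; ck.
Qed.

Lemma deform_smooth : smooth_C2_on domain deform.
Proof.
  split; [|split; [|split]]; apply smooth_on_of_Ck; try exact HU; intros n;
    destruct (Ck_polar n) as [H1 [H2 [H3 H4]]]; simpl; ck.
Qed.

Lemma density_Ck n : Ck n domain density.
Proof.
  destruct (Ck_displacement n) as [HY [HT [HYx [HTx HYs]]]].
  destruct (Ck_actions n) as [HA HB].
  unfold density, Rdiv; ck.
  apply (Ck_sqrt domain HU n gram_factor);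
    [intros t r s []; apply gram_factor_pos; auto|].
  assert (HP : Ck n domain action_product) by (unfold action_product; ck).
  unfold gram_factor, gram_cross, Rdiv; ck.
  apply Ck_inv; auto.
  intros t r s [Ht Hr]; generalize (action_product_pos t r s Ht Hr); lra.
Qed.

(** The right-hand side is the cone. *)
Lemma deform_undeformed t r s :
  t = 0 \/ (shift r s = 0 /\ twist r s = 0) -> 0 < r ->
  deform t r s =
  scal r (scal (/ sqrt (p + q))
    ((RtoC (sqrt q) * cis (sqrt (p / q) * s))%C,
     (Ci * RtoC (sqrt p) * cis (- (sqrt (q / p) * s)))%C)).
Proof.
  intros H Hr.
  assert (E : t * shift r s = 0 /\ t * twist r s = 0)
    by (destruct H as [->|[-> ->]]; split; ring).
  destruct E as [E1 E2].
  unfold deform, radius1, radius2, angle1, angle2.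
  rewrite E1, E2, Rminus_0_r, !Rplus_0_r, !sqrt_div_alt by lra.
  unfold scal; simpl; unfold prod_scal, scal; simpl; unfold prod_scal, scal;
    simpl; unfold mult, cis, Ci, RtoC, Cmult; simpl.
  unfold Rdiv; f_equal; f_equal; ring.
Qed.

(** The deformation is supported in 1 <= r <= exp (1 / e). *)
Lemma displacement_out r s : e * ln r <= 0 \/ 1 <= e * ln r ->
  shift r s = 0 /\ twist r s = 0.
Proof.
  intros H; unfold shift, twist, amplitude, amplitude1; rewrite !chi_out by auto.
  unfold Rdiv; split; ring.
Qed.

(** * The second variation of area *)

(** At t = 0 the Gram factor is p q and its derivative is (p - q) * [shift], which
    produces the term in (p - q) ^ 2. *)
Lemma density_second_derivative r s (g1 : R -> R) (g2 : R) : 0 < r ->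
  (forall t, Rabs t < time_bound ->
    is_derive (fun t => density t r s) t (g1 t)) ->
  is_derive g1 0 g2 ->
  g2 = r / (p * q) * (- shift r s ^ 2 + p * q * twist_x r s ^ 2
    + shift_x r s ^ 2 / 2
    + (shift_s r s ^ 2 - (p - q) ^ 2 * shift r s ^ 2) / (4 * (p * q))).
Proof.
  intros Hr D1 D2.
  assert (He0 : 0 < time_bound) by (apply Rinv_0_lt_compat; lra).
  assert (H0 : Rabs 0 < time_bound) by (rewrite Rabs_R0; exact He0).
  assert (Hs := sqrt_pq).
  set (y := shift r s); set (a := shift_x r s); set (b := shift_s r s).
  set (c := twist_x r s); set (k := gram_cross r s).
  (* the derivative of the Gram factor with respect to t *)
  set (w1 := fun t =>
    (y * (p - t * y) - y * (q + t * y)) * (1 + t ^ 2 * c ^ 2)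
    + ((q + t * y) * (p - t * y)) * (2 * t * c ^ 2) + t * a ^ 2
    + ((t * b ^ 2 / 2 + 4 * t ^ 3 * k ^ 2) * ((q + t * y) * (p - t * y))
       - (t ^ 2 * b ^ 2 / 4 + t ^ 4 * k ^ 2)
         * (y * (p - t * y) - y * (q + t * y)))
      / ((q + t * y) * (p - t * y)) ^ 2).
  rewrite (sqrt_second_derivative (fun t => gram_factor t r s) w1 g1
    (- 2 * y ^ 2 + 2 * (p * q) * c ^ 2 + a ^ 2 + b ^ 2 / (2 * (p * q))) g2
    (r / sqrt (p * q)) time_bound); auto.
  - assert (E : gram_factor 0 r s = p * q)
      by (unfold gram_factor, action_product; field; lra).
    rewrite E; unfold w1.
    assert (Eq := sqrt_sqrt (p * q) ltac:(nra)).
    set (u := sqrt (p * q)) in *; clearbody u; rewrite <- Eq.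
    clear w1 E; clearbody y a b c k.
    field; lra.
  - intros t Ht; apply gram_factor_pos; auto.
  - intros t Ht; unfold gram_factor, action_product, w1; fold y a b c k.
    assert (HA := action1_pos t r s Ht Hr).
    assert (HB := action2_pos t r s Ht Hr).
    fold y in HA, HB.
    auto_derive; [apply Rgt_not_eq, Rmult_lt_0_compat; lra|].
    field; lra.
  - unfold w1.
    auto_derive;
      [repeat apply Rmult_integral_contrapositive_currified; lra|].
    field; lra.
Qed.

(** After integration over s, the second variation is a positive multiple of the
    integral over 0 <= x <= 1 of this function, x standing for e ln r. *)
Definition reduced_integrand (x : R) : R :=
  p * q / 4 * (e ^ 2 * chi 2 x - chi 0%nat x) ^ 2
  + m ^ 2 / 2 * (e * chi 1%nat x - chi 0%nat x) ^ 2
  + ((m ^ 4 - (p - q) ^ 2 * m ^ 2) / (4 * (p * q)) - m ^ 2) * chi 0%nat x ^ 2.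

Lemma reduced_integrand_continuous x : continuous reduced_integrand x.
Proof.
  apply (ex_derive_continuous reduced_integrand).
  unfold reduced_integrand; auto_derive.
  repeat split; auto; eexists; apply Hchi.
Qed.

(** The change of variable x = e ln r. *)
Lemma RInt_log_scale :
  RInt (fun r => reduced_integrand (e * ln r) / r) 1 (exp (/ e))
  = RInt reduced_integrand 0 1 / e.
Proof.
  assert (Hb : 1 < exp (/ e)).
  { rewrite <- exp_0; apply exp_increasing, Rinv_0_lt_compat; auto. }
  assert (E :
    RInt (fun r => scal (e / r) (reduced_integrand (e * ln r))) 1 (exp (/ e))
    = RInt reduced_integrand (e * ln 1) (e * ln (exp (/ e)))).
  { apply (RInt_comp reduced_integrand (fun r => e * ln r) (fun r => e / r)).
    - intros; apply reduced_integrand_continuous.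
    - intros r Hr; rewrite Rmin_left in Hr by lra; split.
      + auto_derive; [lra|field; lra].
      + apply (ex_derive_continuous (fun r => e / r)); auto_derive; lra. }
  rewrite ln_1, ln_exp, Rmult_0_r, Rinv_r in E by lra.
  rewrite <- E.
  replace (RInt _ 1 (exp (/ e)) / e)
    with (scal (/ e) (RInt
      (fun r => scal (e / r) (reduced_integrand (e * ln r))) 1 (exp (/ e))))
    by (unfold scal; simpl; unfold mult; simpl; field; lra).
  rewrite <- @RInt_scal.
  - apply RInt_ext; intros r Hr; rewrite Rmin_left in Hr by lra.
    unfold scal; simpl; unfold mult; simpl; field; lra.
  - apply @ex_RInt_continuous; intros r Hr; rewrite Rmin_left in Hr by lra.
    apply (continuous_mult (fun r => e / r)
      (fun r => reduced_integrand (e * ln r))).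
    + apply (ex_derive_continuous (fun r => e / r)); auto_derive; lra.
    + apply (continuous_comp (fun r => e * ln r) reduced_integrand);
        [|apply reduced_integrand_continuous].
      apply (ex_derive_continuous (fun r => e * ln r)); auto_derive; lra.
Qed.

(** [L] stands for the length of the s-interval; the condition on the sine makes the
    integrals of sin^2 and cos^2 both equal to L / 2. *)
Lemma deform_negative_second_variation L : 0 < L -> sin (frequency * L) = 0 ->
  RInt reduced_integrand 0 1 < 0 ->
  negative_second_variation (fun t => RInt (fun r => RInt (fun s =>
    area_element (partial_C2 Vr deform t r s) (partial_C2 Vs deform t r s))
    0 L) 1 (exp (/ e))).
Proof.
  intros HL Hsin Hneg.
  assert (Hb : 1 < exp (/ e)).
  { rewrite <- exp_0; apply exp_increasing, Rinv_0_lt_compat; auto. }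
  assert (He0 : 0 < time_bound) by (apply Rinv_0_lt_compat; lra).
  assert (H0 : Rabs 0 < time_bound) by (rewrite Rabs_R0; exact He0).
  set (A := fun t => RInt _ _ _).
  (* f1 and f2 are the first two t-derivatives of the density *)
  destruct (density_Ck 2) as [C0 D0]; destruct (D0 Vt) as [f1 [D1 [C1 D1']]].
  destruct (D1' Vt) as [f2 [D2 [C2 _]]]; clear D0 D1'; simpl in D1, D2.
  assert (Near : locally 0 (fun t => Rabs t < time_bound)).
  { exists (mkposreal time_bound He0); intros t Ht.
    change (Rabs (t - 0) < time_bound) in Ht; rewrite Rminus_0_r in Ht; exact Ht. }
  assert (I1 := is_derive_double_RInt density f1 time_bound 1 (exp (/ e)) L
    ltac:(lra) ltac:(lra) (fun t r s Ht Hr => C0 t r s (conj Ht Hr))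
    (fun t r s Ht Hr => C1 t r s (conj Ht Hr))
    (fun t r s Ht Hr => D1 t r s (conj Ht Hr))).
  assert (I2 := is_derive_double_RInt f1 f2 time_bound 1 (exp (/ e)) L
    ltac:(lra) ltac:(lra) (fun t r s Ht Hr => C1 t r s (conj Ht Hr))
    (fun t r s Ht Hr => C2 t r s (conj Ht Hr))
    (fun t r s Ht Hr => D2 t r s (conj Ht Hr)) 0 H0).
  set (A1 := fun t => RInt (fun r => RInt (f1 t r) 0 L) 1 (exp (/ e))) in *.
  assert (Oe : open (fun t => Rabs t < time_bound)).
  { apply (open_comp Rabs (fun y => y < time_bound)); [|apply open_lt].
    intros; apply continuous_Rabs. }
  assert (DA : forall t, Rabs t < time_bound -> is_derive A t (A1 t)).
  { intros t Ht.
    apply is_derive_ext_loc with (2 := I1 t Ht).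
    generalize (Oe t Ht); apply filter_imp; intros u Hu; unfold A.
    apply RInt_ext; intros r Hr; rewrite Rmin_left in Hr by lra.
    apply RInt_ext; intros s _; symmetry; apply deform_area_element; auto; lra. }
  assert (DA1 : is_derive (Derive A) 0
    (RInt (fun r => RInt (f2 0 r) 0 L) 1 (exp (/ e)))).
  { apply is_derive_ext_loc with A1; [|exact I2].
    revert Near; apply filter_imp; intros t Ht.
    symmetry; apply is_derive_unique, DA, Ht. }
  split; [|split].
  - revert Near; apply filter_imp; intros t Ht; exists (A1 t); apply DA, Ht.
  - eexists; exact DA1.
  - change (Derive_n A 2 0) with (Derive (Derive A) 0).
    rewrite (is_derive_unique _ _ _ DA1).
    replace (RInt (fun r => RInt (f2 0 r) 0 L) 1 (exp (/ e)))
      with (L / (2 * (p * q)) * (RInt reduced_integrand 0 1 / e)).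
    + assert (0 < L / (2 * (p * q))) by (apply Rdiv_lt_0_compat; nra).
      assert (RInt reduced_integrand 0 1 / e < 0).
      { unfold Rdiv; assert (0 < / e) by (apply Rinv_0_lt_compat; auto); nra. }
      nra.
    + rewrite <- RInt_log_scale.
      change (L / (2 * (p * q))
        * RInt (fun r => reduced_integrand (e * ln r) / r) 1 (exp (/ e)))
        with (scal (L / (2 * (p * q)))
          (RInt (fun r => reduced_integrand (e * ln r) / r) 1 (exp (/ e)))).
      rewrite <- @RInt_scal.
      * apply RInt_ext; intros r Hr; rewrite Rmin_left in Hr by lra.
        assert (Hr0 : 0 < r) by lra.
        (* f2 0 is the second t-derivative of the density at t = 0; its terms
           are sorted into sin^2 and cos^2 *)
        rewrite (RInt_ext (f2 0 r) (fun s =>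
          r / (p * q) * (- (m * amplitude r) ^ 2 + (m * amplitude1 r) ^ 2 / 2
            - (p - q) ^ 2 * (m * amplitude r) ^ 2 / (4 * (p * q)))
            * sin (frequency * s) ^ 2
          + r / (p * q) * (p * q * (amplitude1 r + amplitude2 r / 2) ^ 2
            + (m ^ 2 * amplitude r) ^ 2 / (4 * (p * q)))
            * cos (frequency * s) ^ 2)).
        -- rewrite RInt_sin2_cos2; auto.
           ++ unfold amplitude, amplitude1, amplitude2, reduced_integrand.
              unfold scal; simpl; unfold mult; simpl.
              field; lra.
           ++ apply Rgt_not_eq, Rdiv_lt_0_compat; auto; apply sqrt_pq.
        -- intros s _.
           rewrite (density_second_derivative r s (fun t => f1 t r s) (f2 0 r s)).
           ++ match goal with |- ?x = ?y => change (@eq R x y) end.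
              unfold shift, shift_x, shift_s, twist_x; field; lra.
           ++ exact Hr0.
           ++ intros t Ht; apply (D1 t r s); split; auto.
           ++ apply (D2 0 r s); split; auto.
      * apply @ex_RInt_continuous; intros r Hr; rewrite Rmin_left in Hr by lra.
        apply (continuous_mult (fun r => reduced_integrand (e * ln r))
          (fun r => / r)).
        -- apply (continuous_comp (fun r => e * ln r) reduced_integrand);
             [|apply reduced_integrand_continuous].
           apply (ex_derive_continuous (fun r => e * ln r)); auto_derive; lra.
        -- apply (ex_derive_continuous (fun r => / r)); auto_derive; lra.
Qed.

End Deformation.

(** The integral is continuous in the scale [e] and negative at e = 0. *)
Lemma exists_slow_scale (chi : nat -> R -> R) m p q :
  (forall n x, is_derive (chi n) x (chi (S n) x)) ->
  (forall x, 0 < x < 1 -> 0 < chi O x) ->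
  0 < p -> 0 < q -> (p * q - m ^ 2) ^ 2 < (p - q) ^ 2 * m ^ 2 ->
  exists e, 0 < e /\ RInt (reduced_integrand chi e m p q) 0 1 < 0.
Proof.
  intros Hchi Hpos Hp Hq Hm.
  assert (HU : open3 (fun _ _ _ => True)) by apply open_true.
  assert (HC : Ck 0 (fun _ _ _ => True)
    (fun e _ x => reduced_integrand chi e m p q x)).
  { assert (Hk : forall n, Ck 0 (fun _ _ _ => True) (fun _ _ x => chi n x)).
    { intros n; apply (Ck_comp _ (fun _ => True) chi 0 (fun _ _ x => x) n);
        auto; ck. }
    unfold reduced_integrand, Rminus, Rdiv; ck; apply Hk. }
  assert (C : continuous (fun e => RInt (reduced_integrand chi e m p q) 0 1) 0).
  { apply (continuous_RInt_param _ (fun e => reduced_integrand chi e m p q));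
      [lra| |].
    - intros x _.
      apply (continuous_comp (fun z : R * R => (fst z, 0, snd z))
        (uncurry3 (fun e _ x => reduced_integrand chi e m p q x))).
      + repeat apply continuous_pair;
          [apply continuous_fst|apply continuous_const|apply continuous_snd].
      + apply (Ck_continuous _ _ _ HC); exact I.
    - apply filter_forall; intros e; apply @ex_RInt_continuous; intros x _.
      apply reduced_integrand_continuous; auto. }
  (* at e = 0 the integrand is c * chi ^ 2 *)
  set (c := ((p * q - m ^ 2) ^ 2 - (p - q) ^ 2 * m ^ 2) / (4 * (p * q))).
  assert (Hc : c < 0).
  { unfold c, Rdiv.
    assert (0 < / (4 * (p * q))) by (apply Rinv_0_lt_compat; nra). nra. }
  assert (Neg0 : RInt (reduced_integrand chi 0 m p q) 0 1 < 0).
  { assert (I : 0 < RInt (fun x => - c * chi O x ^ 2) 0 1).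
    { apply RInt_gt_0; [lra| |].
      - intros x Hx; apply Rmult_lt_0_compat; [lra|apply pow_lt, Hpos, Hx].
      - intros x _; apply (ex_derive_continuous (fun x => - c * chi O x ^ 2)).
        auto_derive; eexists; apply Hchi. }
    replace (RInt (reduced_integrand chi 0 m p q) 0 1)
      with (opp (RInt (fun x => - c * chi O x ^ 2) 0 1)).
    - revert I; generalize (RInt (fun x => - c * chi O x ^ 2) 0 1).
      intros y Hy; change (- y < 0); lra.
    - rewrite <- @RInt_opp.
      + apply RInt_ext; intros x _; unfold reduced_integrand, c, opp; simpl.
        field; lra.
      + apply @ex_RInt_continuous; intros x _.
        apply (ex_derive_continuous (fun x => - c * chi O x ^ 2)).
        auto_derive; eexists; apply Hchi. }
  destruct (C (fun y : R => y < 0) (open_lt 0 _ Neg0)) as [d Hd].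
  exists (d / 2); assert (Hd0 := cond_pos d); split; [lra|].
  apply Hd; change (Rabs (d / 2 - 0) < d); apply Rabs_def1; lra.
Qed.

Lemma cis_period_Z (x : R) (k : Z) :
  cos (x + 2 * IZR k * PI) = cos x /\ sin (x + 2 * IZR k * PI) = sin x.
Proof.
  assert (N : forall n y, cos (y + 2 * INR n * PI) = cos y /\
    sin (y + 2 * INR n * PI) = sin y)
    by (intros; split; [apply cos_period|apply sin_period]).
  destruct (Z_le_gt_dec 0 k) as [H|H].
  - rewrite <- (Z2Nat.id k H), <- INR_IZR_INZ; apply N.
  - destruct (N (Z.to_nat (- k)) (x + 2 * IZR k * PI)) as [H1 H2].
    rewrite INR_IZR_INZ, Z2Nat.id, opp_IZR in H1, H2 by lia.
    rewrite <- H1, <- H2; split; f_equal; ring.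
Qed.

Theorem proposition7p3 :
  forall p q : Z,
    (0 < p)%Z -> (0 < q)%Z -> rel_prime p q -> (1 < Z.abs (p - q))%Z ->
    strictly_unstable_cone p q.
Proof.
  intros p q Hp Hq _ Hpq.
  destruct bump_exists as [chi [Hchi [chi_bound [chi_pos chi_out]]]].
  set (m := (Z.min p q + 1)%Z).
  assert (Hp1 : 1 <= IZR p) by (apply IZR_le; lia).
  assert (Hq1 : 1 <= IZR q) by (apply IZR_le; lia).
  assert (Hm : 0 < IZR m) by (apply IZR_lt; lia).
  assert (Hs : 0 < sqrt (IZR p * IZR q)) by (apply sqrt_lt_R0; nra).
  (* m lies strictly between p and q *)
  destruct (exists_slow_scale chi (IZR m) (IZR p) (IZR q)) as [e [He Hneg]];
    auto; try lra.
  { assert (B : (IZR m - IZR p) * (IZR m - IZR q) < 0).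
    { rewrite <- !minus_IZR, <- mult_IZR; apply IZR_lt.
      unfold m; destruct (Z.min_spec p q) as [[? ->]|[? ->]]; nia. }
    assert (0 < (IZR m + IZR p) * (IZR m + IZR q)) by nra.
    nra. }
  assert (Hb : 1 < exp (/ e)).
  { rewrite <- exp_0; apply exp_increasing, Rinv_0_lt_compat; auto. }
  assert (Hper : frequency (IZR m) (IZR p) (IZR q) * period p q = 2 * IZR m * PI)
    by (unfold frequency, period; field; lra).
  exists (time_bound (IZR m)), 1, (exp (/ e)),
    (deform chi e (IZR m) (IZR p) (IZR q)).
  split; [apply Rinv_0_lt_compat; lra|split; [lra|split]].
  - constructor.
    + apply deform_smooth; auto.
    + intros t r s _ _.
      assert (Ecs : forall r s,
        shift chi e (IZR m) (IZR p) (IZR q) r (s + period p q) =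
        shift chi e (IZR m) (IZR p) (IZR q) r s /\
        twist chi e (IZR m) (IZR p) (IZR q) r (s + period p q) =
        twist chi e (IZR m) (IZR p) (IZR q) r s).
      { clear t r s; intros r s; unfold shift, twist.
        rewrite Rmult_plus_distr_l, Hper.
        destruct (cis_period_Z (frequency (IZR m) (IZR p) (IZR q) * s) m)
          as [-> ->].
        auto. }
      destruct (Ecs r s) as [EY ET].
      unfold deform, radius1, radius2, angle1, angle2; rewrite EY, ET.
      rewrite (sqrt_ratio (IZR p) (IZR q)), (sqrt_ratio (IZR q) (IZR p)) by lra.
      rewrite (Rmult_comm (IZR q) (IZR p)).
      replace (IZR p / sqrt (IZR p * IZR q) * (s + period p q) + _)
        with (IZR p / sqrt (IZR p * IZR q) * s
          + t * twist chi e (IZR m) (IZR p) (IZR q) r s + 2 * IZR p * PI)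
        by (unfold period; field; lra).
      replace (- (IZR q / sqrt (IZR p * IZR q) * (s + period p q)) + _)
        with (- (IZR q / sqrt (IZR p * IZR q) * s)
          + t * twist chi e (IZR m) (IZR p) (IZR q) r s + 2 * IZR (- q) * PI)
        by (rewrite opp_IZR; unfold period; field; lra).
      rewrite !(proj1 (cis_period_Z _ _)), !(proj2 (cis_period_Z _ _)).
      reflexivity.
    + intros r s Hr; apply deform_undeformed; auto.
    + intros t r s _ Hr Hout; apply deform_undeformed; auto; right.
      apply displacement_out; auto.
      destruct Hout as [H|H].
      * left. rewrite <- (Rmult_0_r e), <- ln_1.
        apply Rmult_le_compat_l; [lra|apply ln_le; lra].
      * right. replace 1 with (e * / e) by (field; lra).
        apply Rmult_le_compat_l; [lra|].
        rewrite <- (ln_exp (/ e)); apply ln_le; [apply exp_pos|exact H].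
    + intros t r s Ht Hr; apply lin_indep_of_gram.
      rewrite deform_gram; auto.
      apply Rmult_lt_0_compat; [apply pow_lt, Rdiv_lt_0_compat; auto|].
      apply gram_factor_pos; auto.
    + intros t r s Ht Hr; apply deform_lagrangian; auto.
  - apply deform_negative_second_variation; auto.
    + unfold period; generalize PI_RGT_0; intros Hpi.
      apply Rmult_lt_0_compat; [lra|exact Hs].
    + rewrite Hper, <- (Rplus_0_l (_ * PI)), (proj2 (cis_period_Z 0 m)).
      apply sin_0.
Qed.
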